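(* Let $k$ be an algebraically closed field of characteristic $p>0$, let $e\ge 1$ with $p^e>2$, let $c\in k\setminus\{0\}$, and for $i=1,2$ let $L_i(T)=\alpha_{i,e}T^{p^e}+\alpha_{i,e-1}T^{p^{e-1}}+\cdots+\alpha_{i,0}T\in k[T]$ with $\alpha_{i,e}\alpha_{i,0}\neq 0$. Let $X$ be the smooth model of the plane curve over $k$ defined by $L_1(x)\cdot L_2(y)+c=0$, and let $\varphi:X\to\mathbb{P}^3$ be the morphism given by $(x:y:1:xy)$. Then $\varphi$ is an embedding, and the linear system on $X$ induced by $\varphi$ is complete.
   Context: $X$ is the smooth projective model, and $\varphi$ is the unique extension to $X$ of the rational map given by the functions $x,y,1,xy\in k(X)$. The linear system induced by $\varphi$ is the set of divisors $\varphi^*H$, for $H$ a hyperplane of $\mathbb{P}^3$; it is complete if it equals the set of all effective divisors linearly equivalent to $\varphi^*H$. *)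

(* Defs.v *)
From HB Require Import structures.
From mathcomp Require Import all_boot all_order all_algebra.
From mathcomp Require Import boolp classical_sets functions cardinality.
From mathcomp Require Import mpoly.

Set Implicit Arguments.
Unset Strict Implicit.
Unset Printing Implicit Defensive.

Import Order.TTheory GRing.Theory Num.Theory.
Local Open Scope classical_set_scope.
Local Open Scope ring_scope.

(* Varieties over an algebraically closed field, in the classical language:
   a set of (closed) points, its Zariski-open sets, and for each open set the
   k-valued functions regular on it. [regular U f] only constrains the values
   of [f] on [U]. No axioms are imposed: the record only carries the data, for the
   two concrete instances [Proj] and [smooth_model] below and their subsets. *)
Record variety (k : fieldType) := Variety {
  pt :> Type;
  opens : set (set pt);
  regular : set pt -> (pt -> k) -> Prop
}.

Definition morphism (k : fieldType) (S T : variety k) (f : S -> T) : Prop :=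
  forall V : set T, opens V ->
    opens (f @^-1` V) /\
    forall h : T -> k, regular V h -> regular (f @^-1` V) (h \o f).

Definition isomorphism (k : fieldType) (S T : variety k) (f : S -> T) : Prop :=
  exists g : T -> S, [/\ cancel f g, cancel g f, morphism f & morphism g].

(* The structure induced on a subset Z: the subspace topology, and the functions
   which are locally restrictions of regular functions of the ambient variety. *)
Definition subvariety (k : fieldType) (T : variety k) (Z : set T) : variety k :=
  @Variety k {t : T | Z t}
    [set U | exists2 V : set T, opens V & U = @proj1_sig T Z @^-1` V]
    (fun U f => forall z, U z -> exists V : set T, exists h : T -> k,
       [/\ opens V, V (proj1_sig z), regular V h &
           forall w, U w -> V (proj1_sig w) -> f w = h (proj1_sig w)]).

Definition corestrict (A B : Type) (f : A -> B) (a : A) : {b : B | range f b} :=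
  exist _ (f a) (ex_intro2 _ _ a I erefl).

(* f is an isomorphism of its source onto a closed subvariety of its target. *)
Definition embedding (k : fieldType) (S T : variety k) (f : S -> T) : Prop :=
  opens (~` range f) /\
  @isomorphism k S (subvariety (range f)) (corestrict f).

(* Projective space: the points are the lines through the origin of k^(n+1);
   [<[u]>] is the point with homogeneous coordinates u. *)
Definition proj_pt (k : fieldType) (n : nat) : Type :=
  {L : {vspace 'rV[k]_n.+1} | \dim L == 1%N}.

(* One choice of homogeneous coordinates; it is only used below in conditions
   that do not depend on the choice. *)
Definition hcoord (k : fieldType) (n : nat) (L : proj_pt k n) : 'I_n.+1 -> k :=
  vpick (val L) 0.

Definition proj_open (k : fieldType) (n : nat) (U : set (proj_pt k n)) : Prop :=
  exists2 A : set {mpoly k[n.+1]},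
    (forall h, A h -> exists d : nat, h \is d.-homog) &
    ~` U = [set L | forall h, A h -> h.@[hcoord L] = 0].

Definition proj_regular (k : fieldType) (n : nat)
    (U : set (proj_pt k n)) (f : proj_pt k n -> k) : Prop :=
  forall L, U L -> exists (V : set (proj_pt k n)) (d : nat) (g h : {mpoly k[n.+1]}),
    [/\ proj_open V, V L, g \is d.-homog, h \is d.-homog &
        forall M, V M -> h.@[hcoord M] != 0 /\
                         f M = g.@[hcoord M] / h.@[hcoord M]].

Definition Proj (k : fieldType) (n : nat) : variety k :=
  Variety (@proj_open k n) (@proj_regular k n).

(* The places of a field extension K of k, as normalized discrete valuations of
   K trivial on k. The value at 0 (morally +oo) is fixed to the dummy value 0 so
   that each valuation corresponds to exactly one function. *)
Record place (k K : fieldType) (iota : {rmorphism k -> K}) := Place {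
  ordp :> K -> int;
  ordp0 : ordp 0 = 0;
  ordpM : forall f g, f != 0 -> g != 0 -> ordp (f * g) = ordp f + ordp g;
  ordpD : forall f g, f != 0 -> g != 0 -> f + g != 0 ->
            Num.min (ordp f) (ordp g) <= ordp (f + g);
  ordp_const : forall a : k, a != 0 -> ordp (iota a) = 0;
  ordp_onto : exists2 t, t != 0 & ordp t = 1
}.

(* f lies in the local ring at P and takes the value a there, i.e. f - a lies in
   the maximal ideal. *)
Definition has_value (k K : fieldType) (iota : {rmorphism k -> K})
    (P : place iota) (f : K) (a : k) : Prop :=
  f = iota a \/ 0 < P (f - iota a).

Definition place_open (k K : fieldType) (iota : {rmorphism k -> K})
    (U : set (place iota)) : Prop :=
  U = set0 \/ finite_set (~` U).

Definition place_regular (k K : fieldType) (iota : {rmorphism k -> K})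
    (U : set (place iota)) (h : place iota -> k) : Prop :=
  exists g : K, forall P, U P -> has_value P g (h P).

(* The smooth projective model of a function field K of one variable over the
   algebraically closed field k: the set of its places, with the cofinite
   topology, the regular functions on U being the elements of K that lie in the
   local rings of all the points of U. *)
Definition smooth_model (k K : fieldType) (iota : {rmorphism k -> K}) : variety k :=
  Variety (@place_open k K iota) (@place_regular k K iota).

(* The value F(x, y) in K; the outer variable of F is the first one. *)
Definition eval2 (k K : fieldType) (iota : {rmorphism k -> K})
    (F : {poly {poly k}}) (x y : K) : K :=
  (map_poly (map_poly iota) F).[x, y].

(* K is the function field of the plane curve F = 0, with coordinate functions x
   and y: the subring k[x, y] of K is k[X, Y]/(F), and K is its field of
   fractions. *)
Definition is_function_field (k K : fieldType) (iota : {rmorphism k -> K})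
    (x y : K) (F : {poly {poly k}}) : Prop :=
  (forall G, eval2 iota G x y = 0 <-> exists H, G = H * F) /\
  (forall z : K, exists G H,
     eval2 iota H x y != 0 /\ z = eval2 iota G x y / eval2 iota H x y).

(* phi coincides with the rational map given by the functions f_0, ..., f_n at
   the points where these are all regular and do not all vanish. *)
Definition extends_rational_map (k K : fieldType) (iota : {rmorphism k -> K})
    (n : nat) (f : 'I_n.+1 -> K) (phi : smooth_model iota -> Proj k n) : Prop :=
  forall (P : place iota) (u : 'rV[k]_n.+1),
    (forall i, has_value P (f i) (u 0 i)) -> u != 0 -> val (phi P) = <[u]>%VS.

Definition is_divisor (k K : fieldType) (iota : {rmorphism k -> K})
    (D : place iota -> int) : Prop :=
  finite_set [set P | D P != 0].

Definition effective (k K : fieldType) (iota : {rmorphism k -> K})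
    (D : place iota -> int) : Prop :=
  forall P, 0 <= D P.

Definition lin_equiv (k K : fieldType) (iota : {rmorphism k -> K})
    (D E : place iota -> int) : Prop :=
  exists2 g : K, g != 0 & forall P : place iota, D P - E P = P g.

(* D = phi^* H for the hyperplane H : a_0 X_0 + ... + a_n X_n = 0: near each point
   P, H has the local equation (a_0 X_0 + ... + a_n X_n) / X_j = 0 for some j with
   X_j nonzero at phi(P), and D P is the order at P of the pullback g of this
   equation. As g has to be nonzero, H does not contain the image of phi. *)
Definition hyperplane_pullback (k K : fieldType) (iota : {rmorphism k -> K})
    (n : nat) (phi : smooth_model iota -> Proj k n) (a : 'rV[k]_n.+1)
    (D : place iota -> int) : Prop :=
  forall P : place iota, exists (j : 'I_n.+1) (U : set (place iota)) (g : K),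
    [/\ place_open U, U P, g != 0, D P = P g &
        forall Q, U Q -> hcoord (phi Q) j != 0 /\
          has_value Q g ((\sum_i a 0 i * hcoord (phi Q) i) / hcoord (phi Q) j)].

Definition linear_system (k K : fieldType) (iota : {rmorphism k -> K})
    (n : nat) (phi : smooth_model iota -> Proj k n) : set (place iota -> int) :=
  [set D | exists2 a : 'rV[k]_n.+1, a != 0 & hyperplane_pullback phi a D].

Definition complete_linear_system (k K : fieldType) (iota : {rmorphism k -> K})
    (n : nat) (phi : smooth_model iota -> Proj k n) : Prop :=
  exists2 D0, linear_system phi D0 &
    linear_system phi = [set D | [/\ is_divisor D, effective D & lin_equiv D D0]].

Definition additive_poly (k : fieldType) (p e : nat) (alpha : 'I_e.+1 -> k) :
    {poly k} :=
  \sum_(j < e.+1) alpha j *: 'X^(p ^ j).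

(* L1(X) * L2(Y) + c, where X is the outer variable and Y the inner one. *)
Definition curve_poly (k : fieldType) (L1 L2 : {poly k}) (c : k) : {poly {poly k}} :=
  L1^:P * L2%:P + c%:P%:P.

(* Main.v *)
Require Import Defs.
From HB Require Import structures.
From mathcomp Require Import all_boot all_order all_algebra.
From mathcomp Require Import boolp classical_sets functions cardinality.
From mathcomp Require Import mpoly zify ring separable.

(* On the affine curve, and in the coordinates (1/x, y) and (x, 1/y) near the poles
   of x and y, the curve is smooth: there L1(x) L2(y) + c = 0 has a nonzero partial
   derivative because L1' and L2' are nonzero constants. So each place is the
   valuation of the local ring at a point, with an explicit uniformizer: there are
   the affine points (a, b), q = p^e places with x = a, L1(a) = 0 where y has a
   simple pole and x - a vanishes to order q, and symmetrically q places over y = b,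
   L2(b) = 0.

   Since an element of the function field is determined by its values at infinitely
   many places, X_i / X_j pulls back to f_i / f_j for a morphism phi that extends
   (f_0 : ... : f_3) = (x : y : 1 : xy). This determines phi(P) at the poles. The
   image is cut out in the quadric X_0 X_1 = X_2 X_3 by homogenizations of the
   equation of the curve, and elements of a local ring are quotients of forms.

   The hyperplane sections are div(l) + D with l in the span of 1, x, y, xy and D
   the sum of the poles of x and y, so completeness means L(D) = <1, x, y, xy>. A
   function f in L(D) is G(x, y) / d(y) with deg_x G < q. At a root b of d, G(x, b)
   has the q roots of L1 = - c / L2(b) if L2(b) <> 0, while if L2(b) = 0 it
   vanishes since otherwise f would have too large a pole at the place over b; so
   d can be cancelled. The pole orders of f then bound both degrees of G by one. *)

Set Implicit Arguments.
Unset Strict Implicit.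
Unset Printing Implicit Defensive.

Import Order.TTheory GRing.Theory Num.Theory.
Local Open Scope ring_scope.

(** * Orders and values of functions at a place *)

Section PlaceTheory.
Variables (k K : fieldType) (iota : {rmorphism k -> K}) (P : place iota).
Implicit Types (f g : K) (a b : k) (n m : int).

Definition ordge n f := f = 0 \/ n <= P f.

Lemma ordp1 : P 1 = 0.
Proof. by rewrite -(rmorph1 iota) ordp_const ?oner_neq0. Qed.

Lemma ordpN f : P (- f) = P f.
Proof.
have [->|f0] := eqVneq f 0; first by rewrite oppr0.
rewrite -mulN1r ordpM ?oppr_eq0 ?oner_neq0 //.
by rewrite -(rmorph1 iota) -rmorphN ordp_const ?oppr_eq0 ?oner_neq0 // add0r.
Qed.

Lemma ordpV f : P f^-1 = - P f.
Proof.
have [->|f0] := eqVneq f 0; first by rewrite invr0 ordp0 oppr0.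
apply/eqP; rewrite -addr_eq0 -ordpM ?invr_eq0 // mulVf //; apply/eqP/ordp1.
Qed.

Lemma ordpX f (i : nat) : P (f ^+ i) = P f *+ i.
Proof.
have [->|f0] := eqVneq f 0.
  by case: i => [|i]; rewrite ?expr0 ?ordp1 ?mulr0n // expr0n /= !ordp0 mul0rn.
elim: i => [|i IH]; first by rewrite expr0 ordp1 mulr0n.
by rewrite exprS ordpM ?expf_neq0 // IH mulrS.
Qed.

Lemma ordge0 n : ordge n 0. Proof. by left. Qed.

Lemma ordgeW n m f : m <= n -> ordge n f -> ordge m f.
Proof. by move=> mn [->|h]; [left|right; apply: le_trans h]. Qed.

Lemma ordgeD n f g : ordge n f -> ordge n g -> ordge n (f + g).
Proof.
move=> [->|hf]; first by rewrite add0r.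
move=> [->|hg]; first by rewrite addr0; right.
have [->|f0] := eqVneq f 0; first by rewrite add0r; right.
have [->|g0] := eqVneq g 0; first by rewrite addr0; right.
have [fg|fg] := eqVneq (f + g) 0; first by left.
right; apply: le_trans (ordpD P f0 g0 fg).
by rewrite le_min hf hg.
Qed.

Lemma ordgeN n f : ordge n f -> ordge n (- f).
Proof. by move=> [->|h]; [rewrite oppr0; left|right; rewrite ordpN]. Qed.

Lemma ordgeB n f g : ordge n f -> ordge n g -> ordge n (f - g).
Proof. by move=> hf hg; apply: ordgeD => //; apply: ordgeN. Qed.

Lemma ordgeM n m f g : ordge n f -> ordge m g -> ordge (n + m) (f * g).
Proof.
have [->|f0] := eqVneq f 0; first by rewrite mul0r; left.
have [->|g0] := eqVneq g 0; first by rewrite mulr0; left.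
move=> [/eqP|hf]; first by rewrite (negPf f0).
move=> [/eqP|hg]; first by rewrite (negPf g0).
by right; rewrite ordpM // lerD.
Qed.

Lemma ordge_iota a : ordge 0 (iota a).
Proof.
have [->|a0] := eqVneq a 0; first by rewrite rmorph0; left.
by right; rewrite ordp_const.
Qed.

Lemma ordge_neq0 n f : f != 0 -> ordge n f -> n <= P f.
Proof. by move=> /eqP f0 []. Qed.

Lemma has_valueE f a : has_value P f a <-> ordge 1 (f - iota a).
Proof.
split; case=> h; [left; by rewrite h subrr|right; by rewrite -gtz0_ge1| |].
  by left; apply/eqP; rewrite -subr_eq0 h.
by right; rewrite gtz0_ge1.
Qed.

Lemma has_value0 f : has_value P f 0 <-> ordge 1 f.
Proof. by rewrite has_valueE rmorph0 subr0. Qed.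

Lemma has_value_ordge f a : has_value P f a -> ordge 0 f.
Proof.
move=> /has_valueE h; rewrite -(subrK (iota a) f).
by apply: ordgeD (ordge_iota _); apply: ordgeW h.
Qed.

Lemma has_value_iota a : has_value P (iota a) a.
Proof. by left. Qed.

Lemma has_value1 : has_value P 1 1.
Proof. by left; rewrite rmorph1. Qed.

Lemma has_value_zero : has_value P 0 0.
Proof. by left; rewrite rmorph0. Qed.

Lemma has_valueD f g a b :
  has_value P f a -> has_value P g b -> has_value P (f + g) (a + b).
Proof.
move=> /has_valueE hf /has_valueE hg; apply/has_valueE.
by rewrite rmorphD opprD addrACA; apply: ordgeD.
Qed.

Lemma has_valueN f a : has_value P f a -> has_value P (- f) (- a).
Proof. by move=> /has_valueE hf; apply/has_valueE; rewrite rmorphN -opprD; apply: ordgeN. Qed.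

Lemma has_valueB f g a b :
  has_value P f a -> has_value P g b -> has_value P (f - g) (a - b).
Proof. by move=> hf hg; apply: has_valueD => //; apply: has_valueN. Qed.

Lemma has_valueM f g a b :
  has_value P f a -> has_value P g b -> has_value P (f * g) (a * b).
Proof.
move=> hf /[dup] hg /has_valueE hg'; apply/has_valueE.
have -> : f * g - iota (a * b) = (f - iota a) * g + iota a * (g - iota b).
  by rewrite rmorphM; ring.
move/has_valueE: hf => hf; apply: ordgeD.
  by rewrite -[1](addr0 1); apply: ordgeM => //; apply: has_value_ordge hg.
by rewrite -[1](add0r 1); apply: ordgeM => //; apply: ordge_iota.
Qed.

Lemma has_valueX f a (i : nat) : has_value P f a -> has_value P (f ^+ i) (a ^+ i).
Proof.
by move=> h; elim: i => [|i IH]; rewrite ?exprS; [apply: has_value1|apply: has_valueM].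
Qed.

Lemma has_value_sum I (r : seq I) (Q : pred I) (F : I -> K) (v : I -> k) :
  (forall i, Q i -> has_value P (F i) (v i)) ->
  has_value P (\sum_(i <- r | Q i) F i) (\sum_(i <- r | Q i) v i).
Proof.
by move=> h; apply: big_ind2 => //; [apply: has_value_zero|move=> *; apply: has_valueD].
Qed.

(** If [f] were zero or had positive order, so would the nonzero constant [iota a], which differs
    from [f] by an element of positive order. *)
Lemma has_value_neq0 f a : has_value P f a -> a != 0 -> f != 0 /\ P f = 0.
Proof.
move=> hf a0.
have f0 : f != 0.
  apply/eqP => f0; move/has_valueE: hf; rewrite f0 sub0r => /ordgeN.
  rewrite opprK => /ordge_neq0; rewrite fmorph_eq0 => /(_ a0).
  by rewrite ordp_const.
split=> //; apply/eqP; rewrite eq_le; apply/andP; split; last first.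
  by apply: ordge_neq0 f0 _; apply: has_value_ordge hf.
rewrite leNgt; apply/negP => Pf.
have : ordge 1 (iota a).
  rewrite -(subKr f (iota a)); apply: ordgeB; first by right; rewrite -gtz0_ge1.
  by apply/has_valueE.
by move/ordge_neq0; rewrite fmorph_eq0 => /(_ a0); rewrite ordp_const.
Qed.

Lemma has_value_uniq f a b : has_value P f a -> has_value P f b -> a = b.
Proof.
move=> ha hb; have := has_valueB ha hb; rewrite subrr => h.
apply/eqP; rewrite -subr_eq0; apply/negPn/negP => ab.
by have [/eqP] := has_value_neq0 h ab.
Qed.

Lemma has_valueV f a : has_value P f a -> a != 0 -> has_value P f^-1 a^-1.
Proof.
move=> hf a0; have [f0 Pf] := has_value_neq0 hf a0.
apply/has_valueE; have -> : f^-1 - iota a^-1 = - (f^-1 * iota a^-1 * (f - iota a)).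
  have ia0 : iota a != 0 by rewrite fmorph_eq0.
  by rewrite fmorphV; field; rewrite f0 ia0.
apply: ordgeN; rewrite -[1]add0r -[0]addr0; apply: ordgeM; last exact/has_valueE.
by apply: ordgeM; [right; rewrite ordpV Pf|apply: ordge_iota].
Qed.

Lemma has_value_div f g a b : has_value P f a -> has_value P g b -> b != 0 ->
  has_value P (f / g) (a / b).
Proof. by move=> hf hg b0; apply: has_valueM => //; apply: has_valueV. Qed.

Lemma inv_value_contra f a : has_value P f a -> has_value P f^-1 0 -> f != 0 -> False.
Proof.
move=> h1 h2 f0; have := has_valueM h2 h1; rewrite mulVf // mul0r.
by move/has_value_uniq/(_ has_value1)/eqP; rewrite eq_sym oner_eq0.
Qed.

Lemma has_value_horner (u : {poly k}) f a : has_value P f a ->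
  has_value P (map_poly iota u).[f] u.[a].
Proof.
move=> h; elim/poly_ind: u => [|u c IH].
  by rewrite rmorph0 !horner0; apply: has_value_zero.
rewrite rmorphD rmorphM /= map_polyX map_polyC !hornerE.
by apply: has_valueD (has_value_iota _); apply: has_valueM.
Qed.

End PlaceTheory.

(** The remaining fields of a place are proofs, identified by proof irrelevance. *)
Lemma eq_place (k K : fieldType) (iota : {rmorphism k -> K}) (P Q : place iota) :
  (forall f, P f = Q f) -> P = Q.
Proof.
case: P Q => [o a b c d e] [o' a' b' c' d' e'] /= /funext oo.
by case: _ / oo in a' b' c' d' e' *; congr Place; apply: Prop_irrelevance.
Qed.

(** * Evaluation of polynomials in two variables *)

Section Eval2.
Variables (k K : fieldType) (iota : {rmorphism k -> K}) (x y : K).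
Local Notation ev G := (eval2 iota G x y).

Lemma eval2D G H : ev (G + H) = ev G + ev H.
Proof. by rewrite /eval2 rmorphD !hornerE. Qed.

Lemma eval2N G : ev (- G) = - ev G.
Proof. by rewrite /eval2 rmorphN !hornerE. Qed.

Lemma eval2B G H : ev (G - H) = ev G - ev H.
Proof. by rewrite eval2D eval2N. Qed.

Lemma eval2M G H : ev (G * H) = ev G * ev H.
Proof. by rewrite /eval2 rmorphM !hornerE. Qed.

Lemma eval2_0 : ev 0 = 0.
Proof. by rewrite /eval2 rmorph0 !horner0. Qed.

Lemma eval2C (d : {poly k}) : ev d%:P = (map_poly iota d).[y].
Proof. by rewrite /eval2 map_polyC hornerC. Qed.

Lemma eval2_1 : ev 1 = 1.
Proof. by rewrite -[1 in LHS]/(1%:P) eval2C rmorph1 -[1]/(1%:P) hornerC. Qed.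

Lemma eval2X : ev 'X = x.
Proof. by rewrite /eval2 map_polyX hornerX hornerC. Qed.

Lemma eval2_map (d : {poly k}) : ev d^:P = (map_poly iota d).[x].
Proof.
have -> : eval2 iota d^:P x y = (map_poly iota d)^:P.[x, y].
  rewrite /eval2; congr (_ .[_, _]); apply/polyP => i.
  by rewrite !coef_map /= map_polyC.
by rewrite -swapXY_polyC horner2_swapXY hornerC.
Qed.

Lemma eval2E G : ev G = \sum_(i < size G) (map_poly iota G`_i).[y] * x ^+ i.
Proof.
rewrite /eval2 (@horner_coef_wide _ (size G) _ x%:P) ?size_poly //.
rewrite horner_sum; apply: eq_bigr => i _.
by rewrite hornerM horner_exp hornerC coef_map.
Qed.

End Eval2.

Section Value2.
Variables (k K : fieldType) (iota : {rmorphism k -> K}) (P : place iota).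

Lemma has_value_eval2 x y a b (G : {poly {poly k}}) :
  has_value P x a -> has_value P y b -> has_value P (eval2 iota G x y) G.[a, b].
Proof.
move=> hx hy; elim/poly_ind: G => [|G c IH].
  by rewrite eval2_0 !horner0; apply: has_value_zero.
rewrite eval2D eval2M eval2X eval2C !hornerE.
by apply: has_valueD; [apply: has_valueM|apply: has_value_horner].
Qed.

End Value2.

Lemma eval2_swap (k K : fieldType) (iota : {rmorphism k -> K}) x y G :
  eval2 iota (swapXY G) y x = eval2 iota G x y.
Proof. by rewrite /eval2 -swapXY_map horner2_swapXY. Qed.

Lemma leq_sizeM (R : idomainType) (p q : {poly R}) :
  p != 0 -> (size q <= size (p * q)%R)%N.
Proof.
have [->|q0] := eqVneq q 0; first by rewrite size_poly0.
by move=> p0; rewrite size_mul //; move: p0; rewrite -size_poly_gt0; lia.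
Qed.

Lemma horner2_1 (R : comNzRingType) (a b : R) : (1 : {poly {poly R}}).[a%:P].[b] = 1.
Proof. by rewrite -[1 in LHS]/(1%:P) hornerC -[1 in LHS]/(1%:P) hornerC. Qed.

(** * The function field of a plane curve and the local ring at a smooth point *)

Section FunctionField.
Variables (k K : fieldType) (iota : {rmorphism k -> K}) (x y : K).
Variable E : {poly {poly k}}.
Hypothesis ff : is_function_field iota x y E.
Hypothesis E_gt1 : (1 < size E)%N.
Local Notation ev G := (eval2 iota G x y).

Lemma ff_ker G H : G = H * E -> ev G = 0.
Proof. by move=> ->; apply/ff.1; exists H. Qed.

(** A nonzero multiple of [E] has at least the degree of [E] in the outer variable. *)
Lemma ff_size G : ev G = 0 -> (size G < size E)%N -> G = 0.
Proof.
move=> /ff.1[H ->]; have [->|H0] := eqVneq H 0; first by rewrite mul0r.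
have E0 : E != 0 by rewrite -size_poly_gt0 ltnW.
by rewrite ltnNge leq_sizeM.
Qed.

Lemma ff_transcendental (d : {poly k}) : (map_poly iota d).[y] = 0 -> d = 0.
Proof.
rewrite -(eval2C iota x) => /ff_size; rewrite size_polyC => h.
apply/eqP; rewrite -polyC_eq0 h //; apply: leq_ltn_trans E_gt1; exact: leq_b1.
Qed.

(** The resultant of [E] and [G] with respect to the outer variable plays the role of a norm: it
    lies in the ideal generated by [E] and [G], and depends on [y] only. *)
Lemma ff_norm G : ev G != 0 ->
  exists G' d, d != 0 /\ ev G * ev G' = (map_poly iota d).[y].
Proof.
move=> G0; have [sG|sG] := leqP (size G) 1.
  exists 1, G`_0; rewrite {2}[G]size1_polyC // eval2_1 mulr1.
  split; last by rewrite eval2C.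
  by apply: contraNneq G0 => h; rewrite [G]size1_polyC // h eval2_0.
have [[u v] _ /= e] := resultant_in_ideal E_gt1 sG.
exists v, (resultant E G); split; last first.
  by rewrite -(eval2C iota x) e eval2D (ff_ker (erefl (u * E))) add0r eval2M mulrC.
have E0 : E != 0 by rewrite -size_poly_gt0 ltnW.
(* A zero resultant gives a common factor [g] of positive degree, with [E] equal to [h * g] up to a
   factor in [y]. If [h] vanishes at [(x, y)], it is a multiple of [E], and [g] has degree 0; if [g]
   vanishes there, so does [G]. *)
rewrite resultant_eq0 -leqNgt leqNgt; apply/negP => sg.
have /Pdiv.Idomain.dvdpP[[c1 h] /= c10 e1] := Pdiv.Idomain.dvdp_gcdl E G.
have /Pdiv.Idomain.dvdpP[[c2 m] /= c20 e2] := Pdiv.Idomain.dvdp_gcdr E G.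
set g := Pdiv.Idomain.gcdp E G in sg e1 e2.
have : ev (h * g) = 0.
  by rewrite -e1 -mul_polyC; apply: (@ff_ker _ c1%:P).
rewrite eval2M => /eqP; rewrite mulf_eq0 => /orP[]/eqP.
  move=> /ff.1[h' eh]; have : c1%:P * E = h' * g * E.
    by rewrite mul_polyC e1 eh mulrAC.
  move/(mulIf E0) => ec.
  have h'0 : h' != 0.
    by apply: contraNneq c10 => z; move: ec; rewrite z mul0r => /eqP; rewrite polyC_eq0.
  have := leq_sizeM g h'0; rewrite -ec size_polyC c10 => hs.
  by move: sg; rewrite ltnNge hs.
move=> /ff.1[g' eg].
have : ev (c2%:P * G) = 0.
  by rewrite mul_polyC e2 eg mulrA; apply: (@ff_ker _ (m * g')).
rewrite eval2M => /eqP; rewrite mulf_eq0 (negPf G0) orbF eval2C => /eqP h3.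
by move/ff_transcendental/eqP: h3; rewrite (negPf c20).
Qed.

Section Local.
Variables (a b : k).
Hypothesis Eab : E.[a%:P].[b] = 0.
Hypothesis dEab : E^`().[a%:P].[b] != 0.

(** The partial derivative of [E] in the first variable is nonzero at [(a, b)], so [t] is a local
    parameter at this point. *)
Let t := y - iota b.

(* The local ring of the plane curve at its smooth point [(a, b)]. *)
Definition loc (z : K) := exists A B, B.[a%:P].[b] != 0 /\ z = ev A / ev B.
Definition loc_unit (z : K) :=
  exists A B, [/\ A.[a%:P].[b] != 0, B.[a%:P].[b] != 0 & z = ev A / ev B].

Lemma ev_neq0 B : B.[a%:P].[b] != 0 -> ev B != 0.
Proof.
by apply: contraNneq => /ff.1[H ->]; rewrite !hornerM Eab mulr0.
Qed.

Lemma loc_unitW z : loc_unit z -> loc z.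
Proof. by case=> A [B [_ B0 ->]]; exists A, B. Qed.

Lemma locM z w : loc z -> loc w -> loc (z * w).
Proof.
move=> [A [B [B0 ->]]] [C [D [D0 ->]]]; exists (A * C), (B * D).
by rewrite !hornerM mulf_neq0 // !eval2M mulf_div.
Qed.

Lemma locD z w : loc z -> loc w -> loc (z + w).
Proof.
move=> [A [B [B0 ->]]] [C [D [D0 ->]]]; exists (A * D + C * B), (B * D).
by rewrite !hornerM mulf_neq0 // eval2D !eval2M addf_div ?ev_neq0.
Qed.

Lemma loc_ev G : loc (ev G).
Proof.
by exists G, 1; rewrite horner2_1 oner_neq0 eval2_1 divr1.
Qed.

Lemma ev_t : ev ('X - b%:P)%:P = t.
Proof. by rewrite eval2C rmorphB /= map_polyX map_polyC !hornerE. Qed.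

Lemma loc_t : loc t.
Proof. by rewrite -ev_t; apply: loc_ev. Qed.

Lemma loc1 : loc 1.
Proof.
by rewrite -(eval2_1 iota x y); apply: loc_ev.
Qed.

Lemma locX z n : loc z -> loc (z ^+ n).
Proof.
by move=> lz; elim: n => [|n IH]; rewrite ?exprS; [apply: loc1|apply: locM].
Qed.

Lemma loc_unitM z w : loc_unit z -> loc_unit w -> loc_unit (z * w).
Proof.
move=> [A [B [A0 B0 ->]]] [C [D [C0 D0 ->]]]; exists (A * C), (B * D).
by rewrite !hornerM !mulf_neq0 // !eval2M mulf_div.
Qed.

Lemma loc_unitV z : loc_unit z -> loc_unit z^-1.
Proof. by move=> [A [B [A0 B0 ->]]]; exists B, A; rewrite invf_div. Qed.

Lemma loc_unit_horner (d : {poly k}) : d.[b] != 0 -> loc_unit (map_poly iota d).[y].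
Proof.
move=> d0; by exists d%:P, 1; rewrite horner2_1 hornerC oner_neq0 d0 eval2C eval2_1 divr1.
Qed.

Lemma loc_unit_iota c : c != 0 -> loc_unit (iota c).
Proof.
by move=> c0; have := @loc_unit_horner c%:P; rewrite hornerC map_polyC hornerC; apply.
Qed.

Lemma loc_unit_neq0 z : loc_unit z -> z != 0.
Proof. by move=> [A [B [A0 B0 ->]]]; rewrite mulf_neq0 ?invr_eq0 ?ev_neq0. Qed.

(** Clearing denominators in [t * A / B = C / D] gives a multiple of [E]; its value at [(a, b)],
    which is zero, is [- C * B] there. *)
Lemma t_not_unit z : loc z -> ~ loc_unit (t * z).
Proof.
move=> [A [B [B0 ->]]] [C [D [C0 D0]]].
rewrite -ev_t mulrA => e.
have : ev (('X - b%:P)%:P * A * D - C * B) = 0.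
  rewrite eval2B !eval2M; apply/eqP; rewrite subr_eq0; apply/eqP.
  by apply/eqP; rewrite -eqr_div ?ev_neq0 //; apply/eqP.
move=> /ff.1[H /(congr1 (fun G => G.[a%:P].[b]))].
rewrite !hornerM Eab mulr0 !(hornerE, hornerD, hornerN, hornerM) subrr.
move/eqP; rewrite !mul0r sub0r oppr_eq0 mulf_eq0 (negPf B0) orbF.
by rewrite (negPf C0).
Qed.

Lemma t_neq0 : t != 0.
Proof.
apply/eqP; rewrite -ev_t eval2C => /ff_transcendental/eqP.
by rewrite polyXsubC_eq0.
Qed.

(** Division by [X - a], then division of the remainder by [Y - b]. *)
Lemma taylor1 (G : {poly {poly k}}) : exists G1 g2,
  G = ('X - a%:P%:P) * G1 + ((('X - b%:P) * g2) + G.[a%:P].[b]%:P)%:P.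
Proof.
have /factor_theorem[G1 e1] : root (G - G.[a%:P]%:P) a%:P.
  by rewrite rootE hornerD hornerN hornerC subrr.
have /factor_theorem[g2 e2] : root (G.[a%:P] - G.[a%:P].[b]%:P) b.
  by rewrite rootE hornerD hornerN hornerC subrr.
exists G1, g2; rewrite mulrC -e1 [_ * g2]mulrC -e2 subrK.
by rewrite subrK.
Qed.

(** Write [E = (X - a) * E1 + (Y - b) * e2]. Then [E1] takes at [(a, b)] the value of the partial
    derivative, so it can be inverted in the local ring. *)
Lemma loc_x : exists2 r, loc r & x - iota a = t * r.
Proof.
have [E1 [e2]] := taylor1 E; rewrite Eab addr0 => e.
have E10 : E1.[a%:P].[b] != 0.
  move: dEab; rewrite e derivD derivM derivB derivX !derivC subr0 mul1r addr0.
  by rewrite !hornerE subrr mul0r addr0.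
exists (- ev e2%:P / ev E1); first by exists (- e2%:P), E1; rewrite eval2N.
have : ev E = 0 by apply: (@ff_ker _ 1); rewrite mul1r.
rewrite {1}e eval2D polyCM !eval2M ev_t eval2B eval2X eval2C map_polyC hornerC.
move/eqP; rewrite addr_eq0 => /eqP h.
by rewrite mulrA mulrN -h mulfK ?ev_neq0.
Qed.

Lemma loc_root A : A.[a%:P].[b] = 0 -> exists2 r, loc r & ev A = t * r.
Proof.
move=> A0; have [A1 [g2]] := taylor1 A; rewrite A0 addr0 => e.
have [r lr er] := loc_x.
exists (r * ev A1 + ev g2%:P).
  by apply: locD (loc_ev _); apply: locM lr (loc_ev _).
rewrite {1}e eval2D polyCM !eval2M ev_t eval2B eval2X eval2C map_polyC hornerC.
by rewrite er mulrDr mulrA.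
Qed.

(** Induction on [n]: a non-unit [f] is divisible by [t], which is cancelled on both sides. For
    [n = 0] the product [f * r] is a unit, hence so is [f]. Thus [n] bounds how often [t] can be
    split off. *)
Lemma loc_split f r n u : loc f -> loc r -> loc_unit u -> f * r = t ^+ n * u ->
  exists m u', loc_unit u' /\ f = t ^+ m * u'.
Proof.
move=> lf lr lu; elim: n f lf => [|n IH] f [A [B [B0 ->]]];
  have [A0|A0] := eqVneq (A.[a%:P].[b]) 0.
- have [s ls es] := loc_root A0; rewrite expr0 mul1r es => e.
  case: (@t_not_unit (s / ev B * r)); last by rewrite !mulrA e.
  apply: locM => //; apply: locM => //; exists 1, B; split=> //.
  by rewrite eval2_1 mul1r.
- by move=> _; exists 0%N, (ev A / ev B); split; [exists A, B|rewrite expr0 mul1r].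
- have [s ls es] := loc_root A0; rewrite es exprS -!mulrA.
  move/(mulfI t_neq0); rewrite mulrA => /IH.
  case=> [|m [u' [lu' e]]].
    apply: locM => //; exists 1, B; split=> //.
    by rewrite eval2_1 mul1r.
  by exists m.+1, u'; rewrite exprS -mulrA e.
- by move=> _; exists 0%N, (ev A / ev B); split; [exists A, B|rewrite expr0 mul1r].
Qed.

(** The norm of [G] is a polynomial in [y], hence [t ^+ n] times a unit, with [n] the multiplicity
    of its root [b]. *)
Lemma loc_split_ev G : ev G != 0 ->
  exists m u', loc_unit u' /\ ev G = t ^+ m * u'.
Proof.
move=> /ff_norm[G' [d [d0 e]]].
have [n [q [q0 eq]]] := multiplicity_XsubC d b.
apply: (@loc_split _ (ev G') n (map_poly iota q).[y]); rewrite ?d0 //.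
- exact: loc_ev.
- exact: loc_ev.
- by apply: loc_unit_horner; move: q0; rewrite d0.
by rewrite e eq rmorphM rmorphXn rmorphB /= map_polyX map_polyC !hornerE mulrC.
Qed.

Lemma unif z : z != 0 -> exists (n : int) u, loc_unit u /\ z = t ^ n * u.
Proof.
have [G [H [H0 ->]]] := ff.2 z.
rewrite mulf_eq0 negb_or => /andP[/loc_split_ev[m [u [lu ->]]] _].
have [m' [u' [lu' ->]]] := loc_split_ev H0.
exists (m%:Z - m'%:Z), (u / u'); split.
  by apply: loc_unitM lu _; apply: loc_unitV.
by rewrite expfzDr ?t_neq0 // -exprnN -exprnP invfM mulrACA.
Qed.

(** If [n < m], cancelling [t ^ n] makes the unit [u] a multiple of [t]. *)
Lemma unif_le (n m : int) u z : loc_unit u -> loc z -> t ^ n * u = t ^ m * z -> m <= n.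
Proof.
move=> lu lz e; rewrite leNgt; apply/negP => nm.
have [j ej] : exists j : nat, m = n + j.+1%:Z by exists (`|m - n|.-1)%N; lia.
move: e; rewrite ej expfzDr ?t_neq0 // -mulrA => /mulfI.
rewrite expfz_eq0 (negPf t_neq0) andbF => /(_ isT) e.
apply: (@t_not_unit (t ^+ j * z)); last by rewrite mulrA -exprS exprnP -e.
by apply: locM lz; apply: locX; apply: loc_t.
Qed.

Lemma unif_uniq (n m : int) u u' : loc_unit u -> loc_unit u' ->
  t ^ n * u = t ^ m * u' -> n = m.
Proof.
move=> lu lu' e; apply/eqP; rewrite eq_le.
by rewrite (unif_le lu (loc_unitW lu') e) (unif_le lu' (loc_unitW lu) (esym e)).
Qed.

(** The exponent of [t] in the factorization [z = t ^ n * u] is a valuation. *)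
Lemma local_place_exists : exists P : place iota,
  has_value P x a /\ has_value P y b.
Proof.
pose Q (z : K) (n : int) := exists2 u, loc_unit u & z = t ^ n * u.
have [o oP] : exists o : K -> int, forall z, z != 0 -> Q z (o z).
  have : forall z, exists n, z != 0 -> Q z n.
    move=> z; have [->|z0] := eqVneq z 0; first by exists 0.
    by have [n [u [lu e]]] := unif z0; exists n => _; exists u.
  by case/choice => o ho; exists o.
(* The record [place] prescribes the value 0 at 0. *)
pose ord z := if z == 0 then 0 else o z.
have ordP z : z != 0 -> Q z (ord z) by move=> z0; rewrite /ord (negPf z0); apply: oP.
have ordU z n : z != 0 -> Q z n -> ord z = n.
  move=> z0 [u lu e]; have [u' lu' e'] := ordP _ z0.
  by apply: (unif_uniq lu' lu); rewrite -e -e'.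
have h0 : ord 0 = 0 by rewrite /ord eqxx.
have hM f g : f != 0 -> g != 0 -> ord (f * g) = ord f + ord g.
  move=> f0 g0; apply: ordU; first by rewrite mulf_neq0.
  have [u lu {1}->] := ordP _ f0; have [u' lu' {1}->] := ordP _ g0.
  exists (u * u'); first exact: loc_unitM.
  by rewrite expfzDr ?t_neq0 // mulrACA.
have hD f g : f != 0 -> g != 0 -> f + g != 0 ->
    Num.min (ord f) (ord g) <= ord (f + g).
  wlog fg : f g / ord f <= ord g => [wl|] f0 g0 fg0.
    have [fg|/ltW fg] := leP (ord f) (ord g).
      by have := wl _ _ fg f0 g0 fg0; rewrite (min_idPl fg).
    by rewrite addrC in fg0 *; have := wl _ _ fg g0 f0 fg0; rewrite (min_idPl fg).
  rewrite (min_idPl fg).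
  have [u lu e] := ordP _ f0; have [u' lu' e'] := ordP _ g0.
  have [u'' lu'' e''] := ordP _ fg0.
  have [j ej] : exists j : nat, ord g = ord f + j%:Z by exists (`|ord g - ord f|)%N; lia.
  (* Here [f + g] is [t ^ ord f] times [u + t ^+ j * u'], an element of the local ring. *)
  apply: (@unif_le _ _ u'' (u + t ^+ j * u')) => //.
    apply: locD; first exact: loc_unitW.
    by apply: locM (loc_unitW lu'); apply: locX; apply: loc_t.
  by rewrite -e'' {1}e {1}e' ej expfzDr ?t_neq0 // mulrDr mulrA exprnP.
have hC c : c != 0 -> ord (iota c) = 0.
  move=> c0; apply: ordU; first by rewrite fmorph_eq0.
  by exists (iota c); [apply: loc_unit_iota|rewrite expr0z mul1r].
have hT n z : z = t ^ n -> ord z = n.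
  move=> ->; apply: ordU; first by rewrite expfz_eq0 (negPf t_neq0) andbF.
  by exists 1; [rewrite -(rmorph1 iota); apply: loc_unit_iota; apply: oner_neq0|rewrite mulr1].
have hO : exists2 z, z != 0 & ord z = 1 by exists t; [apply: t_neq0|apply: hT; rewrite expr1z].
pose P : place iota := Place h0 hM hD hC hO.
have Pt : P t = 1 by apply: hT; rewrite expr1z.
exists P; split; last by right; rewrite -/t Pt.
apply/has_valueE; have [r lr ->] := loc_x.
have [->|r0] := eqVneq r 0; first by rewrite mulr0; left.
right; rewrite ordpM ?t_neq0 // Pt lerDl.
have [u lu e] := ordP _ r0.
by apply: (unif_le lu lr); rewrite -e expr0z mul1r.
Qed.

Section Centered.
Variable P : place iota.
Hypotheses (Px : has_value P x a) (Py : has_value P y b).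

Lemma loc_unit_ord u : loc_unit u -> P u = 0.
Proof.
move=> [A [B [A0 B0 ->]]].
have [_ h] := has_value_neq0 (has_value_div (has_value_eval2 A Px Py)
  (has_value_eval2 B Px Py) B0) (mulf_neq0 A0 (invr_neq0 B0)).
exact: h.
Qed.

Lemma ordp_exprz f (n : int) : P (f ^ n) = P f * n.
Proof.
by case: n => n; rewrite ?NegzE /exprz ?ordpV ordpX pmulrn -?mulrN mulrzz // mulrN.
Qed.

(** An element of order 1 is [t ^ n * u] with [u] of order 0, so [P t] is a positive divisor of
    1. *)
Lemma local_uniformizer : P t = 1.
Proof.
have [z z0 Pz] := ordp_onto P; have [n [u [lu e]]] := unif z0.
have t1 : 1 <= P t by apply: ordge_neq0 t_neq0 _; apply/has_valueE.
have : P t * n = 1.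
  rewrite -Pz e ordpM ?(loc_unit_ord lu) ?addr0 ?ordp_exprz ?(loc_unit_neq0 lu) //.
  by rewrite expfz_eq0 (negPf t_neq0) andbF.
move/(congr1 absz); rewrite abszM => /eqP; rewrite muln_eq1 => /andP[/eqP h _].
by move: t1 h; move: (P t) => m; lia.
Qed.

Lemma ordp_unif (n : int) u : loc_unit u -> P (t ^ n * u) = n.
Proof.
move=> lu; rewrite ordpM ?(loc_unit_ord lu) ?addr0 ?ordp_exprz ?(loc_unit_neq0 lu) //.
  by rewrite local_uniformizer mul1r.
by rewrite expfz_eq0 (negPf t_neq0) andbF.
Qed.

Lemma local_fraction z c : has_value P z c ->
  exists A B, B.[a%:P].[b] != 0 /\ z = ev A / ev B.
Proof.
move=> /has_value_ordge h; have [->|z0] := eqVneq z 0.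
  by exists 0, 1; rewrite horner2_1 oner_neq0 eval2_0 mul0r.
have [n [u [lu e]]] := unif z0.
have : 0 <= n by rewrite -(ordp_unif n lu) -e; apply: ordge_neq0.
case: n e => // n e _; rewrite e; apply: locM (loc_unitW lu).
by apply: locX; apply: loc_t.
Qed.

End Centered.

(** At both places the order of [t ^ n * u] is [n]. *)
Lemma local_place_uniq (P Q : place iota) :
  has_value P x a -> has_value P y b -> has_value Q x a -> has_value Q y b -> P = Q.
Proof.
move=> Px Py Qx Qy; apply: eq_place => z.
have [->|z0] := eqVneq z 0; first by rewrite !ordp0.
by have [n [u [lu ->]]] := unif z0; rewrite !ordp_unif.
Qed.

End Local.
End FunctionField.

(** * The change of coordinates from [y] to [1 / y] *)

Section Inversion.
Variables (k K : fieldType) (iota : {rmorphism k -> K}).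

(* The reversed polynomial [X ^ n * f (1 / X)]. *)
Definition revp n (f : {poly k}) := \poly_(i < n.+1) f`_(n - i).

Lemma horner_revp n (f : {poly k}) (y : K) : y != 0 -> (size f <= n.+1)%N ->
  (map_poly iota (revp n f)).[y] = y ^+ n * (map_poly iota f).[y^-1].
Proof.
move=> y0 sf.
rewrite (@horner_coef_wide _ n.+1); last by rewrite size_map_poly size_poly.
rewrite [in RHS](@horner_coef_wide _ n.+1) ?size_map_poly //.
rewrite (reindex_inj rev_ord_inj) mulr_sumr; apply: eq_bigr => i _ /=.
rewrite !coef_map coef_poly subSS ltnS leq_subr subKn; last by rewrite -ltnS.
rewrite [RHS]mulrCA exprVn; congr (_ * _).
by rewrite expfB_cond // (negPf y0) add0n -ltnS.
Qed.

(** Reversal in the inner variable only: this is [Y ^ n * G (X, 1 / Y)] once [n] bounds the degree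
    of [G] in [Y]. *)
Definition revY n (G : {poly {poly k}}) := \poly_(i < size G) revp n G`_i.

Lemma eval2_wide (x y : K) n (G : {poly {poly k}}) : (size G <= n)%N ->
  eval2 iota G x y = \sum_(i < n) (map_poly iota G`_i).[y] * x ^+ i.
Proof.
move=> sG; rewrite /eval2 (@horner_coef_wide _ n _ x%:P); last first.
  by rewrite (leq_trans _ sG) // size_poly.
by rewrite horner_sum; apply: eq_bigr => i _; rewrite hornerM horner_exp hornerC coef_map.
Qed.

Lemma eval2_revY n (x y : K) G : y != 0 -> (sizeY G <= n.+1)%N ->
  eval2 iota (revY n G) x y = y ^+ n * eval2 iota G x y^-1.
Proof.
move=> y0 sG; rewrite (@eval2_wide _ _ (size G)) ?size_poly // eval2E mulr_sumr.
apply: eq_bigr => i _; rewrite coef_poly ltn_ord horner_revp ?mulrA //.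
exact: leq_trans (max_size_coefXY _ _) sG.
Qed.

Lemma revY_eq0 n G : (sizeY G <= n.+1)%N -> revY n G = 0 -> G = 0.
Proof.
move=> sG /polyP h; apply/polyP => i; apply/polyP => j; rewrite !coef0.
have [iG|iG] := ltnP i (size G); last by rewrite (nth_default 0 iG) coef0.
have [jn|jn] := leqP j n; last first.
  rewrite nth_default //; apply: leq_trans jn.
  exact: leq_trans (max_size_coefXY _ _) sG.
have /polyP/(_ (n - j)%N) := h i.
by rewrite coef_poly iG !coef0 coef_poly ltnS leq_subr subKn.
Qed.

End Inversion.

Lemma ff_swap (k K : fieldType) (iota : {rmorphism k -> K}) x y F :
  is_function_field iota x y F -> is_function_field iota y x (swapXY F).
Proof.
move=> ff; split=> [G|z].
  rewrite -eval2_swap ff.1; split=> -[H e].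
    by exists (swapXY H); rewrite -rmorphM /= -e swapXYK.
  by exists (swapXY H); rewrite e rmorphM /= swapXYK.
have [G [H [H0 ->]]] := ff.2 z.
by exists (swapXY G), (swapXY H); rewrite !eval2_swap.
Qed.

Lemma swap_curve_poly (k : fieldType) (L1 L2 : {poly k}) c :
  swapXY (curve_poly L1 L2 c) = curve_poly L2 L1 c.
Proof.
rewrite /curve_poly rmorphD rmorphM /= swapXY_map_polyC !swapXY_polyC map_polyC.
by rewrite mulrC.
Qed.

(* With [m = L2] and [d = c] this is the given curve; with [m] the reversal of
   [L2] and [d = c * Y ^ q] it is its equation in the coordinates [(x, 1 / y)]. *)
Definition bicurve (k : fieldType) (L m d : {poly k}) : {poly {poly k}} :=
  L^:P * m%:P + d%:P.

Section Bicurve.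
Variables (k : fieldType) (L m d : {poly k}).
Hypotheses (L_gt1 : (1 < size L)%N) (m0 : m != 0).
Local Notation E := (bicurve L m d).

Lemma coef_bicurve i : E`_i = L`_i *: m + (if i == 0%N then d else 0).
Proof. by rewrite coefD coefMC coef_map coefC /= mul_polyC. Qed.

Lemma size_bicurve : size E = size L.
Proof.
apply/eqP; rewrite eqn_leq; apply/andP; split.
  apply/leq_sizeP => j hj; rewrite coef_bicurve nth_default // scale0r add0r.
  by case: j hj => // h; move: L_gt1; rewrite ltnNge; move/negP; case; apply: leq_trans h _.
rewrite leqNgt; apply/negP => h.
have /eqP : E`_(size L).-1 = 0.
  by apply: nth_default; rewrite -ltnS prednK // ltnW.
rewrite coef_bicurve ifN; last by rewrite -lt0n; lia.
rewrite addr0 scaler_eq0 (negPf m0) orbF -lead_coefE lead_coef_eq0 => /eqP L0.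
by move: L_gt1; rewrite L0 size_poly0.
Qed.

Lemma lead_coef_bicurve : lead_coef E = lead_coef L *: m.
Proof.
rewrite lead_coefE size_bicurve coef_bicurve ifN ?addr0 //.
by rewrite -lt0n; lia.
Qed.

Lemma horner_bicurve a b : E.[a%:P].[b] = L.[a] * m.[b] + d.[b].
Proof. by rewrite !hornerE /= horner_map !hornerE. Qed.

Lemma deriv_bicurve a b : E^`().[a%:P].[b] = L^`().[a] * m.[b].
Proof.
by rewrite derivD derivM !derivC mulr0 !addr0 deriv_map !hornerE /= horner_map !hornerE.
Qed.

Lemma eval2_bicurve (K : fieldType) (iota : {rmorphism k -> K}) x y :
  eval2 iota E x y =
  (map_poly iota L).[x] * (map_poly iota m).[y] + (map_poly iota d).[y].
Proof. by rewrite eval2D eval2M eval2_map !eval2C. Qed.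

End Bicurve.

Lemma curve_polyE (k : fieldType) (L1 L2 : {poly k}) c :
  curve_poly L1 L2 c = bicurve L1 L2 c%:P.
Proof. by []. Qed.

(* A factor [Y - b] of [d] does not divide [E], so it divides [Q] and cancels. *)
Lemma dvd_clear_denominator (k : closedFieldType) (d : {poly k})
    (E G Q : {poly {poly k}}) :
  (forall b, root d b -> map_poly (horner_eval b) E != 0) -> d != 0 ->
  d%:P * G = Q * E -> exists Q', G = Q' * E.
Proof.
have [n sd] := ubnP (size d); elim: n => // n IH in d Q sd *.
move=> hE d0 e; have [s1|s1] := boolP (size d == 1%N).
  have /size_poly1P[c c0 ec] := s1.
  exists (c^-1%:P%:P * Q); rewrite -mulrA -e ec mulrA -!polyCM mulVf // mul1r //.
have /closed_rootP[b rb] := s1.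
have rQ i : root Q`_i b.
  have : map_poly (horner_eval b) Q * map_poly (horner_eval b) E = 0.
    rewrite -rmorphM -e rmorphM /= map_polyC /= /horner_eval (rootP rb).
    by rewrite mul0r.
  move/eqP; rewrite mulf_eq0 (negPf (hE _ rb)) orbF => /eqP/polyP/(_ i).
  by rewrite coef_map coef0 /= /horner_eval => /eqP.
have eQ : Q = ('X - b%:P)%:P * map_poly (fun f => f %/ ('X - b%:P)) Q.
  apply/polyP => i; rewrite coefCM coef_map_id0 ?div0p // mulrC divpK //.
  by rewrite dvdp_XsubCl.
have ed : d = (d %/ ('X - b%:P)) * ('X - b%:P) by rewrite divpK // dvdp_XsubCl.
have d10 : d %/ ('X - b%:P) != 0 by apply: contraNneq d0 => z; rewrite ed z mul0r.
apply: (IH (d %/ ('X - b%:P)) (map_poly (fun f => f %/ ('X - b%:P)) Q)) => //.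
- move: sd; rewrite {1}ed size_mul ?polyXsubC_eq0 // size_XsubC.
  by rewrite addnS /= addn1 !ltnS.
- move=> b' rb'; apply: hE; rewrite ed rootM rb' //.
have t0 : ('X - b%:P)%:P != 0 :> {poly {poly k}} by rewrite polyC_eq0 polyXsubC_eq0.
apply: (mulfI t0); rewrite !mulrA -eQ -e; congr (_ * _).
by rewrite -polyCM mulrC -ed.
Qed.

Section Invert.
Variables (k : closedFieldType) (K : fieldType) (iota : {rmorphism k -> K}) (x y : K).
Variables (L1 L2 : {poly k}) (c : k) (q : nat).
Hypotheses (q0 : (0 < q)%N) (s1 : size L1 = q.+1) (s2 : size L2 = q.+1) (c0 : c != 0).
Hypothesis ff : is_function_field iota x y (curve_poly L1 L2 c).
Let M := revp q L2.
Let E := bicurve L1 M (c *: 'X^q).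

(** The constant term of the reversal is the leading coefficient of [L2]. *)
Lemma revp_at0 : M.[0] != 0.
Proof.
rewrite horner_coef0 coef_poly subn0 /= -[q]/(q.+1.-1) -s2 -lead_coefE lead_coef_eq0.
by rewrite -size_poly_gt0 s2.
Qed.

Lemma revp_neq0 : M != 0.
Proof. by apply: contraNneq revp_at0 => ->; rewrite horner0. Qed.

Lemma curve_gt1 : (1 < size (curve_poly L1 L2 c))%N.
Proof. by rewrite curve_polyE size_bicurve ?s1 // -size_poly_gt0 s2. Qed.

Lemma y_neq0 : y != 0.
Proof.
apply/negP => /eqP y0.
have : (map_poly iota 'X).[y] = 0 by rewrite map_polyX hornerX.
by move/(ff_transcendental ff curve_gt1)/eqP; rewrite polyX_eq0.
Qed.

Lemma curve_eq : (map_poly iota L1).[x] * (map_poly iota L2).[y] = - iota c.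
Proof.
apply/eqP; rewrite -addr_eq0 -[X in _ + X](hornerC _ y) -(map_polyC iota).
rewrite -eval2_bicurve; apply/eqP; apply: (ff_ker ff (H := 1)).
by rewrite mul1r.
Qed.

Lemma horner_revp_inv : (map_poly iota M).[y^-1] = y ^- q * (map_poly iota L2).[y].
Proof. by rewrite horner_revp ?s2 // ?invr_eq0 ?y_neq0 // invrK exprVn. Qed.

(** Dividing the equation of the curve by [y ^ q] gives [E]. To see that [E] generates all relations
    between [x] and [1 / y], pseudo-divide [G] by [E]: the remainder is zero, and the power of the
    leading coefficient can be cancelled. *)
Lemma ff_invert : is_function_field iota x y^-1 E.
Proof.
have sE : size E = q.+1 by rewrite size_bicurve ?s1 // revp_neq0.
have E0 : eval2 iota E x y^-1 = 0.
  rewrite eval2_bicurve horner_revp_inv mulrCA curve_eq map_polyZ map_polyXn hornerZ hornerXn.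
  by rewrite exprVn mulrN mulrC addNr.
split=> [G|z]; last first.
  have [G [H [H0 ->]]] := ff.2 z.
  (* One exponent for numerator and denominator, so that the powers of [y] cancel. *)
  pose n := maxn (sizeY G) (sizeY H).
  have yi : y^-1 != 0 by rewrite invr_eq0 y_neq0.
  exists (revY n G), (revY n H).
  rewrite !eval2_revY // ?leqW ?leq_maxl ?leq_maxr // invrK mulf_neq0 ?expf_neq0 //.
  by rewrite -mulf_div divff ?mul1r // expf_neq0.
split=> [|[H ->]]; last by rewrite eval2M E0 mulr0.
move=> G0; pose R := Pdiv.Idomain.modp G E.
pose Q := Pdiv.Idomain.divp G E; pose l := lead_coef E ^+ Pdiv.Idomain.scalp G E.
have e : l%:P * G = Q * E + R by rewrite mul_polyC Pdiv.Idomain.divp_eq.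
have sR : (size R < size E)%N.
  by rewrite Pdiv.Idomain.ltn_modp -size_poly_gt0 sE.
clearbody Q R.
have R0 : R = 0.
  have h : eval2 iota R x y^-1 = 0.
    have eR : R = l%:P * G - Q * E by rewrite e addrAC subrr add0r.
    by rewrite eR eval2B !eval2M G0 E0 !mulr0 subr0.
  (* The reversal of [R] vanishes at [(x, y)] and has smaller degree in [X] than the equation of the
     curve. *)
  apply: (@revY_eq0 _ (sizeY R)) => //.
  apply: (ff_size ff curve_gt1); first by rewrite eval2_revY ?y_neq0 // h mulr0.
  rewrite curve_polyE size_bicurve ?s1 // -?size_poly_gt0 ?s2 //.
  by apply: leq_ltn_trans (size_poly _ _) _; rewrite -sE.
rewrite R0 addr0 in e; apply: dvd_clear_denominator e; last first.
  by rewrite expf_neq0 // lead_coef_eq0 -size_poly_gt0 sE.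
(* A root [b] of the leading coefficient is a root of [M], so it is not 0, and the constant term of
   [E (X, b)] is [c * b ^+ q]. *)
move=> b; rewrite rootE horner_exp expf_eq0 => /andP[_].
rewrite lead_coef_bicurve ?s1 ?revp_neq0 // hornerZ mulf_eq0 lead_coef_eq0.
rewrite -size_poly_eq0 s1 /= => /eqP Mb.
have b0 : b != 0 by apply: contra_eq_neq Mb => ->; apply: revp_at0.
have /eqP h : (c * b ^+ q) != 0 by rewrite mulf_neq0 ?expf_neq0.
apply/eqP => /polyP/(_ 0%N); rewrite coef_map coef0 coef_bicurve /= /horner_eval.
by rewrite !hornerE Mb mulr0 add0r.
Qed.

End Invert.

(** * The places of the curve in its affine charts *)

(** Split off a linear factor [X - b] of [d]: either [z - b] has positive order, or its order is at
    most 0 and the cofactor still vanishes at [P]. *)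
Lemma has_value_root (k : closedFieldType) (K : fieldType) (iota : {rmorphism k -> K})
    (P : place iota) (d : {poly k}) z :
  d != 0 -> has_value P (map_poly iota d).[z] 0 ->
  exists2 b, root d b & has_value P z b.
Proof.
have [n sd] := ubnP (size d); elim: n => // n IH in d sd * => d0 dz.
have [s1|s1] := boolP (size d == 1%N).
  have /size_poly1P[a a0 ed] := s1.
  move: dz; rewrite ed map_polyC hornerC => /has_value_uniq/(_ (has_value_iota _ _)).
  by move/esym/eqP; rewrite (negPf a0).
have /closed_rootP[b rb] := s1.
have [hb|hb] := pselect (has_value P z b); first by exists b.
have ed : d = (d %/ ('X - b%:P)) * ('X - b%:P) by rewrite divpK // dvdp_XsubCl.
have d10 : d %/ ('X - b%:P) != 0 by apply: contraNneq d0 => e; rewrite ed e mul0r.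
have [|//||b' rb' hb'] := IH (d %/ ('X - b%:P)); last by exists b'; rewrite // ed rootM rb'.
- move: sd; rewrite {1}ed size_mul ?polyXsubC_eq0 // size_XsubC.
  by rewrite addnS /= addn1 !ltnS.
have zb : z - iota b != 0.
  by apply/eqP => e; apply: hb; apply/has_valueE; rewrite e; apply: ordge0.
have Pzb : P (z - iota b) <= 0.
  by rewrite leNgt; apply/negP => h; apply: hb; right.
move: dz; rewrite {1}ed rmorphM rmorphB /= map_polyX map_polyC !hornerE !has_value0.
case=> [/eqP|]; first by rewrite mulf_eq0 (negPf zb) orbF => /eqP ->; left.
set w := _.[z]; have [->|w0] := eqVneq w 0; first by left.
rewrite ordpM // => h; right; move: h Pzb.
by move: (P w) (P (z - iota b)) => m m'; lia.
Qed.

Lemma ordge_eval2 (k K : fieldType) (iota : {rmorphism k -> K}) (P : place iota) x y G :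
  ordge P 0 x -> ordge P 0 y -> ordge P 0 (eval2 iota G x y).
Proof.
move=> hx hy; elim/poly_ind: G => [|G d IH]; first by rewrite eval2_0; left.
rewrite eval2D eval2M eval2X eval2C; apply: ordgeD.
  by rewrite -[0](addr0 0); apply: ordgeM.
elim/poly_ind: d => [|d a IHd]; first by rewrite rmorph0 horner0; left.
rewrite rmorphD rmorphM /= map_polyX map_polyC !hornerE; apply: ordgeD (ordge_iota _ _).
by rewrite -[0](addr0 0); apply: ordgeM.
Qed.

(** The additive polynomials enter only through their degree [q] and their nonzero constant
    derivatives. The conditions are symmetric in [x] and [y], so each result about the poles of [y]
    also yields the one about the poles of [x]. *)
Record curve_data (k : closedFieldType) (K : fieldType) (iota : {rmorphism k -> K})
    (x y : K) (L1 L2 : {poly k}) (c : k) (q : nat) : Prop := CurveData {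
  cd_q : (1 < q)%N;
  cd_s1 : size L1 = q.+1;
  cd_s2 : size L2 = q.+1;
  cd_d1 : exists2 u, u != 0 & L1^`() = u%:P;
  cd_d2 : exists2 u, u != 0 & L2^`() = u%:P;
  cd_c : c != 0;
  cd_ff : is_function_field iota x y (curve_poly L1 L2 c)
}.

Lemma curve_data_swap (k : closedFieldType) (K : fieldType) (iota : {rmorphism k -> K})
    x y L1 L2 c q :
  curve_data iota x y L1 L2 c q -> curve_data iota y x L2 L1 c q.
Proof.
by case=> ? ? ? ? ? ? h; split=> //; rewrite -swap_curve_poly; apply: ff_swap.
Qed.

Section Charts.
Variables (k : closedFieldType) (K : fieldType) (iota : {rmorphism k -> K}) (x y : K).
Variables (L1 L2 : {poly k}) (c : k) (q : nat).
Hypothesis cd : curve_data iota x y L1 L2 c q.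
Implicit Types (P Q : place iota) (a b : k).

Let q0 : (0 < q)%N := ltnW (cd_q cd).
Let s1 := cd_s1 cd.
Let s2 := cd_s2 cd.
Let c0 := cd_c cd.
Let ff := cd_ff cd.
Let gt1 := curve_gt1 c q0 s1 s2.
Let ffi := ff_invert q0 s1 s2 c0 ff.

Lemma curve_eqn : (map_poly iota L1).[x] * (map_poly iota L2).[y] = - iota c.
Proof. exact: curve_eq ff. Qed.

Lemma L1_simple a : L1^`().[a] != 0.
Proof. by have [u u0 ->] := cd_d1 cd; rewrite hornerC. Qed.

Lemma L1_neq0 : L1 != 0. Proof. by rewrite -size_poly_gt0 s1. Qed.

Lemma curve_at a b : (curve_poly L1 L2 c).[a%:P].[b] = L1.[a] * L2.[b] + c.
Proof. by rewrite curve_polyE horner_bicurve hornerC. Qed.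

Lemma curve_at_neq0 a b : L1.[a] * L2.[b] + c = 0 -> L1.[a] != 0 /\ L2.[b] != 0.
Proof.
move=> /eqP; rewrite addr_eq0 => /eqP e.
by apply/andP; rewrite -negb_or -mulf_eq0 e oppr_eq0.
Qed.

Lemma deriv_curve_at a b : L1.[a] * L2.[b] + c = 0 ->
  (curve_poly L1 L2 c)^`().[a%:P].[b] != 0.
Proof.
by move=> /curve_at_neq0[_ h]; rewrite curve_polyE deriv_bicurve mulf_neq0 ?L1_simple.
Qed.

Lemma affine_exists a b : L1.[a] * L2.[b] + c = 0 ->
  exists P, has_value P x a /\ has_value P y b.
Proof.
by move=> e; apply: (local_place_exists ff gt1 _ (deriv_curve_at e)); rewrite curve_at.
Qed.

Lemma affine_value P a b : has_value P x a -> has_value P y b ->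
  L1.[a] * L2.[b] + c = 0.
Proof.
move=> hx hy; have := has_value_eval2 (curve_poly L1 L2 c) hx hy; rewrite curve_at.
rewrite (ff_ker ff (H := 1)) ?mul1r // => h.
by apply: has_value_uniq h (has_value_zero _).
Qed.

Lemma affine_uniq P Q a b : has_value P x a -> has_value P y b ->
  has_value Q x a -> has_value Q y b -> P = Q.
Proof.
move=> Px Py; have e := affine_value Px Py.
by apply: (local_place_uniq ff gt1 _ (deriv_curve_at e) Px Py); rewrite curve_at.
Qed.

Lemma affine_fraction P a b z v : has_value P x a -> has_value P y b ->
  has_value P z v -> exists A B, B.[a%:P].[b] != 0 /\
    z = eval2 iota A x y / eval2 iota B x y.
Proof.
move=> Px Py; have e := affine_value Px Py.
by apply: (local_fraction ff gt1 _ (deriv_curve_at e) Px Py); rewrite curve_at.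
Qed.

Let E := bicurve L1 (revp q L2) (c *: 'X^q).

Let Egt1 : (1 < size E)%N.
Proof. by rewrite size_bicurve ?s1 // (revp_neq0 s2). Qed.

Let E_at a : E.[a%:P].[0] = L1.[a] * (revp q L2).[0].
Proof. by rewrite horner_bicurve !hornerE expr0n eqn0Ngt q0 /= mulr0 addr0. Qed.

Let dE_at a : E^`().[a%:P].[0] != 0.
Proof. by rewrite deriv_bicurve mulf_neq0 ?L1_simple ?(revp_at0 s2). Qed.

Lemma inf_exists a : L1.[a] = 0 -> exists P, has_value P x a /\ has_value P y^-1 0.
Proof.
by move=> e; apply: (local_place_exists ffi Egt1 _ (dE_at a)); rewrite E_at e mul0r.
Qed.

Lemma inf_value P a : has_value P x a -> has_value P y^-1 0 -> L1.[a] = 0.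
Proof.
move=> hx hy; have := has_value_eval2 E hx hy; rewrite E_at.
rewrite (ff_ker ffi (H := 1)) ?mul1r // => h.
have /eqP := has_value_uniq h (has_value_zero _).
by rewrite mulf_eq0 (negPf (revp_at0 s2)) orbF => /eqP.
Qed.

Lemma inf_uniq P Q a : has_value P x a -> has_value P y^-1 0 ->
  has_value Q x a -> has_value Q y^-1 0 -> P = Q.
Proof.
move=> Px Py; have e := inf_value Px Py.
by apply: (local_place_uniq ffi Egt1 _ (dE_at a) Px Py); rewrite E_at e mul0r.
Qed.

(** The local parameter at the point [(a, 0)] of the chart [(x, 1 / y)] is [1 / y] itself. *)
Lemma inf_uniformizer P a : has_value P x a -> has_value P y^-1 0 -> P y = - 1.
Proof.
move=> Px Py; have e := inf_value Px Py.
have := local_uniformizer ffi Egt1 _ (dE_at a) Px Py.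
by rewrite E_at e mul0r rmorph0 subr0 => /(_ erefl) <-; rewrite ordpV opprK.
Qed.

Lemma inf_fraction P a z v : has_value P x a -> has_value P y^-1 0 ->
  has_value P z v -> exists A B, B.[a%:P].[0] != 0 /\
    z = eval2 iota A x y^-1 / eval2 iota B x y^-1.
Proof.
move=> Px Py; have e := inf_value Px Py.
by apply: (local_fraction ffi Egt1 _ (dE_at a) Px Py); rewrite E_at e mul0r.
Qed.

(** The reversal of [L2] at [1 / y] is [y ^- q * L2 (y)], and it has a nonzero value at [P]. *)
Lemma ordp_L2_pole P : has_value P y^-1 0 ->
  (map_poly iota L2).[y] != 0 /\ P (map_poly iota L2).[y] = P y *+ q.
Proof.
move=> hy; have := has_value_horner (revp q L2) hy.
rewrite (horner_revp_inv q0 s1 s2 ff) => /has_value_neq0.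
move=> /(_ (revp_at0 s2)); rewrite mulf_eq0 negb_or => -[/andP[h1 h2]].
rewrite ordpM // ordpV ordpX => /eqP; rewrite addrC subr_eq0 => /eqP h.
by split.
Qed.

(** As [L2 (y)] has order [- q] and [L1 (x) * L2 (y) = - c], the order of [L1 (x)] is [q]. Since [a]
    is a simple root of [L1], the factor [x - a] accounts for all of it. *)
Lemma inf_tangency P a : has_value P x a -> has_value P y^-1 0 ->
  P (x - iota a) = q%:Z.
Proof.
move=> Px Py; have e := inf_value Px Py.
have [L20 PL2] := ordp_L2_pole Py.
rewrite (inf_uniformizer Px Py) in PL2.
have L10 : (map_poly iota L1).[x] != 0.
  have : (map_poly iota L1).[x] * (map_poly iota L2).[y] != 0.
    by rewrite curve_eqn oppr_eq0 fmorph_eq0.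
  by rewrite mulf_eq0 negb_or => /andP[].
have PL1 : P (map_poly iota L1).[x] = q%:Z.
  have : P ((map_poly iota L1).[x] * (map_poly iota L2).[y]) = 0.
    by rewrite curve_eqn ordpN ordp_const.
  by rewrite ordpM // PL2 mulNrn => /eqP; rewrite subr_eq0 => /eqP ->; rewrite -natz.
have /factor_theorem[N eN] : root L1 a by apply/eqP.
have N0 : N.[a] != 0.
  have := L1_simple a; rewrite eN derivM derivB derivX derivC subr0 mulr1.
  by rewrite !hornerE subrr mulr0 add0r.
have [Nx PN] := has_value_neq0 (has_value_horner N Px) N0.
move: L10 PL1; rewrite eN rmorphM rmorphB /= map_polyX map_polyC !hornerE.
by rewrite mulf_eq0 negb_or => /andP[_ xa]; rewrite ordpM // PN add0r.
Qed.

(** At a pole of [y], [L1 (x) = - c / L2 (y)] has positive order, so [x] takes a root of [L1] as its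
    value. *)
Lemma pole_inf P : P y < 0 -> exists2 a, has_value P x a & has_value P y^-1 0.
Proof.
move=> Py; have hy : has_value P y^-1 0.
  by apply/has_value0; right; rewrite ordpV; move: (P y) Py => m; lia.
have [L20 PL2] := ordp_L2_pole hy.
have h : has_value P (map_poly iota L1).[x] 0.
  apply/has_value0.
  have -> : (map_poly iota L1).[x] = - iota c * (map_poly iota L2).[y]^-1.
    by rewrite -curve_eqn mulfK.
  right; rewrite ordpM ?invr_eq0 ?oppr_eq0 ?fmorph_eq0 // ordpV ordpN ordp_const // PL2.
  by move: q0 Py; rewrite -mulr_natr natz; move: (P y) => m; nia.
by have [a _ ha] := has_value_root L1_neq0 h; exists a.
Qed.

End Charts.

Section Classification.
Variables (k : closedFieldType) (K : fieldType) (iota : {rmorphism k -> K}) (x y : K).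
Variables (L1 L2 : {poly k}) (c : k) (q : nat).
Hypothesis cd : curve_data iota x y L1 L2 c q.
Let cd' := curve_data_swap cd.

Variant place_spec (P : place iota) : Prop :=
| AffinePlace a b of has_value P x a & has_value P y b
| InfYPlace a of has_value P x a & has_value P y^-1 0
| InfXPlace b of has_value P y b & has_value P x^-1 0.

Lemma place_classify (P : place iota) : place_spec P.
Proof.
have [/(pole_inf cd)[a Px Py]|Py] := ltP (P y) 0; first exact: InfYPlace Px Py.
have [/(pole_inf cd')[b Py' Px]|Px] := ltP (P x) 0; first exact: InfXPlace Py' Px.
(* Now [x] and [y] are both integral at [P]. In an element [G / H] of order 1 the numerator has
   positive order, hence so does its norm, a polynomial in [y]; this makes [y] take a value [b]. *)
have [z z0 Pz] := ordp_onto P.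
have [G [H [H0 ez]]] := (cd_ff cd).2 z.
have gt1 := curve_gt1 c (ltnW (cd_q cd)) (cd_s1 cd) (cd_s2 cd).
have G0 : eval2 iota G x y != 0 by apply: contraNneq z0 => e; rewrite ez e mul0r.
have PG : 1 <= P (eval2 iota G x y).
  have : ordge P 0 (eval2 iota H x y) by apply: ordge_eval2; right.
  move=> /(ordge_neq0 H0); move: Pz; rewrite ez ordpM ?invr_eq0 // ordpV.
  by move: (P _) (P _) => m m'; lia.
have [G' [d [d0 ed]]] := ff_norm (cd_ff cd) gt1 G0.
have [|b _ hb] := @has_value_root _ _ _ P d y d0.
  apply/has_value0; rewrite -ed -[1]addr0; apply: ordgeM; first by right.
  by apply: ordge_eval2; right.
have hL2 := has_value_horner L2 hb; have e := curve_eqn cd.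
have hL1 : ordge P 0 (map_poly iota L1).[x].
  rewrite -(eval2_map iota x y); apply: ordge_eval2; right=> //.
(* Otherwise the nonzero constant [- c] would have positive order. *)
have L2b : L2.[b] != 0.
  apply/eqP => z2; rewrite z2 has_value0 in hL2.
  have := ordgeM hL1 hL2; rewrite e add0r => /ordge_neq0.
  by rewrite ordpN oppr_eq0 fmorph_eq0 ordp_const ?(cd_c cd) // => /(_ isT).
pose w := - c / L2.[b].
have hw : has_value P (map_poly iota L1).[x] w.
  have [L20 _] := has_value_neq0 hL2 L2b.
  have -> : (map_poly iota L1).[x] = iota (- c) / (map_poly iota L2).[y].
    by rewrite rmorphN /= -e mulfK.
  by apply: has_value_div => //; apply: has_value_iota.
(* The value of [x] is found among the roots of [L1 = w]. *)
have [||a _ ha] := @has_value_root _ _ _ P (L1 - w%:P) x.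
- apply/eqP => /eqP; rewrite subr_eq0 => /eqP/(congr1 (fun p : {poly k} => size p)).
  by rewrite (cd_s1 cd) size_polyC => /eqP; have := cd_q cd; case: (w != 0) => /=; lia.
- rewrite rmorphB /= map_polyC !hornerE -(subrr w); apply: has_valueB => //.
  exact: has_value_iota.
exact: AffinePlace ha hb.
Qed.

Lemma no_double_pole (P : place iota) : has_value P x^-1 0 -> has_value P y^-1 0 -> False.
Proof.
have y0 : y != 0 := y_neq0 (ltnW (cd_q cd)) (cd_s1 cd) (cd_s2 cd) (cd_ff cd).
have x0 : x != 0 := y_neq0 (ltnW (cd_q cd')) (cd_s1 cd') (cd_s2 cd') (cd_ff cd').
move=> hx hy; case: (place_classify P) => [a b h1 h2|a h1 h2|b h1 h2].
- exact: inv_value_contra h1 hx x0.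
- exact: inv_value_contra h1 hx x0.
- exact: inv_value_contra h1 hy y0.
Qed.

End Classification.

(** * Finiteness of supports and infinity of the set of places *)

(** The set is covered by the sets [r i], for finitely many labels [i], and each of these has at
    most one element. Places will be labelled by the values of a coordinate. *)
Lemma finite_set_coded (T I : Type) (S : set T) (D : set I) (r : I -> T -> Prop) :
  finite_set D ->
  (forall t, S t -> exists2 i, D i & r i t) ->
  (forall i t t', r i t -> r i t' -> t = t') -> finite_set S.
Proof.
move=> fD cov inj.
apply: (@sub_finite_set _ _ (\bigcup_(i in D) [set t | r i t])%classic).
  by move=> t /cov[i Di rit]; exists i.
apply: bigcup_finite => // i _.
have [[t0 h]|h] := pselect (exists t, r i t).
  by apply: (@sub_finite_set _ _ [set t0]%classic) => // t ht; apply: inj ht h.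
by apply: (@sub_finite_set _ _ set0) => // t ht; apply: h; exists t.
Qed.

Lemma finite_roots (k : closedFieldType) (d : {poly k}) : d != 0 ->
  finite_set [set a | root d a]%classic.
Proof.
move=> d0; have [r er] := closed_field_poly_normal d.
apply: (@sub_finite_set _ _ [set` r]%classic); last exact: finite_seq.
move=> a /=; rewrite er rootZ ?lead_coef_eq0 //.
by rewrite root_prod_XsubC.
Qed.

(** The derivative of [L - w] is a nonzero constant, so [L - w] has no multiple root. *)
Lemma separable_fiber (k : closedFieldType) (L : {poly k}) q w :
  size L = q.+1 -> (0 < q)%N -> (exists2 u, u != 0 & L^`() = u%:P) ->
  exists r : seq k, [/\ uniq r, size r = q & forall a, a \in r -> L.[a] = w].
Proof.
move=> sL q0 [u u0 dL].
have sp : size (L - w%:P) = q.+1.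
  by rewrite size_polyDl sL // size_polyN size_polyC; case: (w != 0); rewrite // ltnS.
have p0 : L - w%:P != 0 by rewrite -size_poly_eq0 sp.
have [r er] := closed_field_poly_normal (L - w%:P).
exists r; split.
- rewrite -separable_prod_XsubC; apply: (@dvdp_separable _ (L - w%:P)).
    by rewrite [X in _ %| X]er dvdpZr ?lead_coef_eq0.
  by rewrite unlock derivB derivC subr0 dL -(alg_polyC u) coprimepZr ?coprimep1.
- move: sp; rewrite er size_scale ?lead_coef_eq0 // size_prod_XsubC => -[] //.
- move=> a ar; have : root (L - w%:P) a by rewrite er rootZ ?lead_coef_eq0 ?root_prod_XsubC.
  by rewrite rootE !hornerE subr_eq0 => /eqP.
Qed.

Section Finiteness.
Variables (k : closedFieldType) (K : fieldType) (iota : {rmorphism k -> K}) (x y : K).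
Variables (L1 L2 : {poly k}) (c : k) (q : nat).
Hypothesis cd : curve_data iota x y L1 L2 c q.
Let cd' := curve_data_swap cd.
Local Open Scope classical_set_scope.

Lemma coord_y_neq0 : y != 0.
Proof. exact: y_neq0 (ltnW (cd_q cd)) (cd_s1 cd) (cd_s2 cd) (cd_ff cd). Qed.

Lemma finite_fiber_y b : finite_set [set P : place iota | has_value P y b].
Proof.
pose d := L2.[b] *: L1 + c%:P.
have d0 : d != 0.
  apply/eqP => /polyP h.
  have [z|z] := eqVneq L2.[b] 0.
    by have := h 0%N; rewrite /d z scale0r add0r coefC /= coef0 => /eqP; rewrite (negPf (cd_c cd)).
  have := h q; rewrite /d coefD coefZ coefC coef0 ifN; last by have := cd_q cd; case: (q).
  rewrite addr0 => /eqP; rewrite mulf_eq0 (negPf z) /= -[q]/(q.+1.-1) -(cd_s1 cd).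
  by rewrite -lead_coefE lead_coef_eq0 -size_poly_eq0 (cd_s1 cd).
(* The label [Some a] stands for the affine point [(a, b)], and [None] for the pole of [x] over
   [y = b]. *)
pose r (o : option k) (P : place iota) := has_value P y b /\
  if o is Some a then has_value P x a else has_value P x^-1 0.
apply: (@finite_set_coded _ _ _ (None |` (Some @` [set a | root d a])) r).
- by rewrite finite_setU; split; [apply: finite_set1|apply/finite_image/finite_roots].
- move=> P Pb; case: (place_classify cd P) => [a b' ha hb'|a ha hb'|b' hb' ha].
  + exists (Some a) => //; right; exists a => //=.
    have := affine_value cd ha hb'; rewrite -(has_value_uniq Pb hb').
    by rewrite /d rootE !hornerE mulrC => ->.
  + by case: (inv_value_contra Pb hb' coord_y_neq0).
  + by exists None => //; left.
- move=> [a|] P Q [/= hb ha] [/= hb' ha'].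
    exact: (affine_uniq cd ha hb ha' hb').
  exact: (inf_uniq cd' hb ha hb' ha').
Qed.

Lemma finite_poles_y : finite_set [set P : place iota | has_value P y^-1 0].
Proof.
pose r a (P : place iota) := has_value P y^-1 0 /\ has_value P x a.
apply: (@finite_set_coded _ _ _ [set a | root L1 a] r).
- exact/finite_roots/(L1_neq0 cd).
- move=> P Py; case: (place_classify cd P) => [a b ha hb|a ha hb|b hb ha].
  + by case: (inv_value_contra hb Py coord_y_neq0).
  + by exists a => //; apply/eqP; apply: (inf_value cd ha hb).
  + by case: (no_double_pole cd ha Py).
- by move=> a P Q [hy hx] [hy' hx']; apply: (inf_uniq cd hx hy hx' hy').
Qed.

Lemma finite_support_y (d : {poly k}) : d != 0 ->
  finite_set [set P : place iota | P (map_poly iota d).[y] != 0].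
Proof.
move=> d0.
apply: (@sub_finite_set _ _ ([set P | has_value P y^-1 0] `|`
   \bigcup_(b in [set b | root d b]) [set P : place iota | has_value P y b])).
  move=> P /= hP; case: (place_classify cd P) => [a b _ hb|a _ hb|b hb _]; first last.
  - right; exists b => //=; apply: contraNT hP => nr.
    by rewrite (has_value_neq0 (has_value_horner d hb) nr).2.
  - by left.
  - right; exists b => //=; apply: contraNT hP => nr.
    by rewrite (has_value_neq0 (has_value_horner d hb) nr).2.
rewrite finite_setU; split; first exact: finite_poles_y.
by apply: bigcup_finite => [|b _]; [apply: finite_roots|apply: finite_fiber_y].
Qed.

End Finiteness.

Section Density.
Variables (k : closedFieldType) (K : fieldType) (iota : {rmorphism k -> K}) (x y : K).
Variables (L1 L2 : {poly k}) (c : k) (q : nat).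
Hypothesis cd : curve_data iota x y L1 L2 c q.
Let cd' := curve_data_swap cd.
Local Open Scope classical_set_scope.

Let gt1 := curve_gt1 c (ltnW (cd_q cd)) (cd_s1 cd) (cd_s2 cd).

(** At an affine place a polynomial in [x] and [y] and its cofactor have orders at least 0, so the
    norm has nonzero order wherever the polynomial has. The norm is a polynomial in [y], and the
    places that are not affine are finite in number. *)
Lemma finite_support (z : K) : z != 0 -> finite_set [set P : place iota | P z != 0].
Proof.
have ev_support G : eval2 iota G x y != 0 ->
    finite_set [set P : place iota | P (eval2 iota G x y) != 0].
  move=> G0; have [G' [d [d0 ed]]] := ff_norm (cd_ff cd) gt1 G0.
  apply: (@sub_finite_set _ _ (([set P | has_value P y^-1 0] `|`
     [set P | has_value P x^-1 0]) `|` [set P : place iota | P (map_poly iota d).[y] != 0])).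
    move=> P /= hP; case: (place_classify cd P) => [a b ha hb|a ha hb|b hb ha].
    - right; rewrite -ed; have dy : (map_poly iota d).[y] != 0.
        by apply: contraNneq d0 => /(ff_transcendental (cd_ff cd) gt1) ->.
      move: dy; rewrite -ed mulf_eq0 negb_or => /andP[_ G'0].
      rewrite ordpM //.
      have /(ordge_neq0 G0) h : ordge P 0 (eval2 iota G x y).
        exact: has_value_ordge (has_value_eval2 G ha hb).
      have /(ordge_neq0 G'0) h' : ordge P 0 (eval2 iota G' x y).
        exact: has_value_ordge (has_value_eval2 G' ha hb).
      by move: hP h h'; move: (P _) (P _) => m m'; lia.
    - by left; left.
    - by left; right.
  rewrite 2!finite_setU; split; first split.
  - exact: (finite_poles_y cd).
  - exact: (finite_poles_y cd').
  - exact: (finite_support_y cd d0).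
move=> z0; have [G [H [H0 ez]]] := (cd_ff cd).2 z.
have G0 : eval2 iota G x y != 0 by apply: contraNneq z0 => e; rewrite ez e mul0r.
apply: (@sub_finite_set _ _ ([set P : place iota | P (eval2 iota G x y) != 0] `|`
  [set P : place iota | P (eval2 iota H x y) != 0])); last first.
  by rewrite finite_setU; split; apply: ev_support.
move=> P /=; rewrite ez ordpM ?invr_eq0 // ordpV => h.
have [e|e] := eqVneq (P (eval2 iota G x y)) 0; last by left.
by right; apply: contraNneq h => ->; rewrite e.
Qed.

Lemma infinite_places : ~ finite_set [set: place iota].
Proof.
move=> fT.
(* The value of [x], with default 0 at the poles of [x]. *)
pose f P := xget 0 [set a | has_value (P : place iota) x a].
have /finite_seqP[s es] := finite_image f fT.
(* As in Euclid's argument, a root [a] of [d] lies outside [s] and is not a root of [L1]; the latter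
   gives an affine point over [a]. *)
pose d := L1 * \prod_(a <- s) ('X - a%:P) + 1.
have sd : size d != 1%N.
  rewrite size_polyDl ?size_poly1 size_mul ?(L1_neq0 cd) ?monic_neq0 ?monic_prod_XsubC //.
    by rewrite (cd_s1 cd) size_prod_XsubC; have := cd_q cd; lia.
  by rewrite (cd_s1 cd) size_prod_XsubC; have := cd_q cd; lia.
have /closed_rootP[a ra] := sd.
have e : L1.[a] * (\prod_(a <- s) ('X - a%:P)).[a] = - 1.
  by move: ra; rewrite rootE !hornerE addr_eq0 => /eqP.
have [L1a] : L1.[a] != 0 /\ (\prod_(a <- s) ('X - a%:P)).[a] != 0.
  by apply/andP; rewrite -negb_or -mulf_eq0 e oppr_eq0 oner_eq0.
rewrite -rootE root_prod_XsubC => /negP; apply.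
have sd2 : size (L1.[a] *: L2 + c%:P) != 1%N.
  rewrite size_polyDl size_scale // (cd_s2 cd) ?size_polyC; have := cd_q cd; case: (c != 0) => /=; lia.
have /closed_rootP[b rb] := sd2.
have [|P [ha hb]] := affine_exists cd (a := a) (b := b).
  by move: rb; rewrite rootE !hornerE => /eqP.
have : (f @` setT) a.
  exists P => //; rewrite /f; case: xgetP => [a' _ ha'|/(_ a)//].
  exact: has_value_uniq ha' ha.
by rewrite es.
Qed.

(** A nonzero difference [g - h] would have positive order at infinitely many places. *)
Lemma eq_of_cofinite (U : set (place iota)) (g h : K) (v : place iota -> k) :
  finite_set (~` U) -> (forall Q, U Q -> has_value Q g (v Q)) ->
  (forall Q, U Q -> has_value Q h (v Q)) -> g = h.
Proof.
move=> fU hg hh; apply/eqP; rewrite -subr_eq0; apply/negPn/negP => gh.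
apply: infinite_places; rewrite -(setUv U) finite_setU; split=> //.
apply: sub_finite_set (finite_support gh) => Q UQ /=.
have := has_valueB (hg _ UQ) (hh _ UQ); rewrite subrr has_value0 => /(ordge_neq0 gh).
by move: (Q _) => m; lia.
Qed.

End Density.

(** * Pole orders and the Riemann-Roch space of the poles of [x] and [y] *)

Section PoleOrder.
Variables (k : fieldType) (K : fieldType) (iota : {rmorphism k -> K}).

Lemma ordge_horner_root (P : place iota) (y : K) b n (g : {poly k}) :
  has_value P y b -> ordge P n (y - iota b) -> root g b ->
  ordge P n (map_poly iota g).[y].
Proof.
move=> hy hb /factor_theorem[h ->].
rewrite rmorphM rmorphB /= map_polyX map_polyC !hornerE -[n]add0r.
by apply: ordgeM => //; apply: has_value_ordge (has_value_horner h hy).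
Qed.

(** After division by [x ^+ i0] the terms with [i < i0] vanish at [P] because [x] has a pole, and
    those with [i > i0] because their coefficients vanish to an order that exceeds the pole of
    [x ^+ (i - i0)]. *)
Lemma has_value_leading (P : place iota) (x y : K) b i0 (G : {poly {poly k}}) :
  has_value P y b -> P x = -1 ->
  (forall i, (i0 < i < size G)%N ->
     ordge P (i - i0).+1%:Z (map_poly iota G`_i).[y]) ->
  has_value P (eval2 iota G x y / x ^+ i0) (G`_i0).[b].
Proof.
move=> hy Px hi.
have x0 : x != 0 by apply: contra_eq_neq Px => ->; rewrite ordp0.
have -> : (G`_i0).[b] = \sum_(i < size G) (if i == i0 :> nat then (G`_i0).[b] else 0).
  rewrite -big_mkcond /=; have [h|h] := ltnP i0 (size G).
    by rewrite (big_pred1 (Ordinal h)).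
  rewrite nth_default // horner0 big1 //.
rewrite eval2E mulr_suml; apply: has_value_sum => i _.
rewrite -mulrA; case: ltngtP => [ii|ii|->]; last first.
- by rewrite divff ?expf_neq0 // mulr1; apply: has_value_horner.
- apply/has_value0; have -> : (1 : int) = (i - i0).+1%:Z + (- (i - i0)%N%:Z) by lia.
  apply: ordgeM; first by apply: hi; rewrite ii ltn_ord.
  right; rewrite ordpM ?invr_eq0 ?expf_neq0 // ordpV !ordpX Px !mulNrn opprK.
  by move: (nat_of_ord i) ii => j ji; rewrite !natz; lia.
apply/has_value0; rewrite -[1]add0r; apply: ordgeM.
  by apply: has_value_ordge (has_value_horner _ hy).
right; rewrite ordpM ?invr_eq0 ?expf_neq0 // ordpV !ordpX Px !mulNrn opprK.
by move: (nat_of_ord i) ii => j ji; rewrite !natz; lia.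
Qed.

(** Coefficients of [G] beyond the degree of [G (X, b)] vanish at [b], so they have order at least
    [q] at [P]; this beats the pole of [x ^+ i] as [i < q]. The pole order is therefore the degree
    of [G (X, b)]. *)
Lemma ordp_leading (P : place iota) (x y : K) b q (G : {poly {poly k}}) :
  has_value P y b -> P x = -1 -> ordge P q%:Z (y - iota b) -> (size G <= q)%N ->
  map_poly (horner_eval b) G != 0 ->
  eval2 iota G x y != 0 /\
  P (eval2 iota G x y) = - ((size (map_poly (horner_eval b) G)).-1)%:Z.
Proof.
move=> hy Px yb sG g0; set g := map_poly _ _ in g0 *; set i0 := (size g).-1.
have x0 : x != 0 by apply: contra_eq_neq Px => ->; rewrite ordp0.
have gi i : g`_i = (G`_i).[b] by rewrite coef_map.
have [||h0 h] := has_value_neq0 (@has_value_leading P x y b i0 G hy Px _).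
- move=> i /andP[ii0 iG]; apply: (@ordgeW _ _ _ _ q%:Z); first by move: (leq_trans iG sG); lia.
  apply: ordge_horner_root yb _ => //; apply/eqP; rewrite -gi nth_default //.
  by move: ii0; rewrite /i0; case: (size g) => //= n; lia.
- by rewrite -gi -lead_coefE lead_coef_eq0.
move: h0; rewrite mulf_eq0 negb_or => /andP[G0 xi]; split=> //.
move: h; rewrite ordpM // ordpV ordpX Px mulNrn opprK natz.
by move: (P _) => m; lia.
Qed.

End PoleOrder.

Section RiemannRoch.
Variables (k : closedFieldType) (K : fieldType) (iota : {rmorphism k -> K}) (x y : K).
Variables (L1 L2 : {poly k}) (c : k) (q : nat).
Hypothesis cd : curve_data iota x y L1 L2 c q.
Let cd' := curve_data_swap cd.
Let q0 : (0 < q)%N := ltnW (cd_q cd).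

Let gt1 := curve_gt1 c q0 (cd_s1 cd) (cd_s2 cd).

Let y_sub_neq0 b : y - iota b != 0.
Proof.
apply/eqP => e; have : (map_poly iota ('X - b%:P)).[y] = 0.
  by rewrite rmorphB /= map_polyX map_polyC !hornerE.
by move/(ff_transcendental (cd_ff cd) gt1)/eqP; rewrite polyXsubC_eq0.
Qed.

(** The norm turns the denominator into a polynomial in [y]; pseudo-division by the equation of the
    curve then lowers the degree of the numerator in [X], at the cost of a further factor in [y]. *)
Lemma quotient_rep f : exists (G : {poly {poly k}}) (d : {poly k}), [/\ d != 0, (size G <= q)%N &
  f * (map_poly iota d).[y] = eval2 iota G x y].
Proof.
have ff := cd_ff cd; have [G [H [H0 ez]]] := ff.2 f.
have [H' [d [d0 ed]]] := ff_norm ff gt1 H0.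
set F := curve_poly L1 L2 c.
have F0 : F != 0 by rewrite -size_poly_gt0 ltnW.
have e1 : f * (map_poly iota d).[y] = eval2 iota (G * H') x y.
  by rewrite -ed eval2M ez mulrA divfK.
pose R := Pdiv.Idomain.modp (G * H') F.
pose l := lead_coef F ^+ Pdiv.Idomain.scalp (G * H') F.
have eR : l%:P * (G * H') = Pdiv.Idomain.divp (G * H') F * F + R.
  by rewrite mul_polyC Pdiv.Idomain.divp_eq.
have sR : (size R < size F)%N by rewrite Pdiv.Idomain.ltn_modp.
clearbody R; exists R, (l * d); split.
- by rewrite mulf_neq0 // expf_neq0 // lead_coef_eq0.
- by move: sR; rewrite /F curve_polyE size_bicurve ?(cd_s1 cd) -?size_poly_gt0 ?(cd_s2 cd).
have /(congr1 (fun A => eval2 iota A x y)) := eR.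
rewrite eval2D (ff_ker ff (erefl (_ * F))) add0r => <-.
by rewrite eval2M -e1 eval2C rmorphM hornerM mulrCA.
Qed.

(* The Riemann-Roch space of the sum of the places where [x] or [y] has a pole. *)
Definition pole_bounded (f : K) := [/\
  forall (P : place iota) a b, has_value P x a -> has_value P y b -> ordge P 0 f,
  forall (P : place iota) a, has_value P x a -> has_value P y^-1 0 -> ordge P (-1) f &
  forall (P : place iota) b, has_value P y b -> has_value P x^-1 0 -> ordge P (-1) f].

Lemma vanish_at_fiber f (G : {poly {poly k}}) d b : pole_bounded f -> (size G <= q)%N -> root d b ->
  f * (map_poly iota d).[y] = eval2 iota G x y -> map_poly (horner_eval b) G = 0.
Proof.
move=> [fA fY fX] sG rd e; set g := map_poly _ G.
have dvan (P : place iota) n : has_value P y b -> ordge P n (y - iota b) ->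
    ordge P n (map_poly iota d).[y].
  by move=> hy yb; apply: ordge_horner_root yb _.
(* If [L2 (b) <> 0], there are [q] affine places over [y = b], and [G (X, b)], of degree below [q],
   vanishes at their [x]-coordinates. *)
have [L2b|L2b] := eqVneq L2.[b] 0; last first.
  have [r [ur sr hr]] := separable_fiber (- c / L2.[b]) (cd_s1 cd) q0 (cd_d1 cd).
  apply/eqP/negPn/negP => g0.
  have : all (root g) r.
    apply/allP => a /hr L1a.
    have [|P [ha hb]] := affine_exists cd (a := a) (b := b).
      by rewrite L1a divfK // addNr.
    have h : has_value P (eval2 iota G x y) 0.
      apply/has_value0; rewrite -e -[1]add0r; apply: ordgeM; first exact: (fA _ _ _ ha hb).
      by apply: dvan => //; apply/has_valueE.
    rewrite rootE; apply/eqP; rewrite -(has_value_uniq (has_value_eval2 G ha hb) h).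
    by rewrite /g -horner_swapXY horner2_swapXY.
  move=> /(max_poly_roots g0)/(_ ur); rewrite sr ltnNge => /negP; apply.
  exact: leq_trans (size_poly _ _) sG.
(* At the pole of [x] over [b], [d (y)] has order at least [q] and [f] at least [-1], so [G (x, y)]
   would have order at least [q - 1 > 0], whereas a nonzero [G (X, b)] makes this order at most
   0. *)
have [P [hb hx]] := inf_exists cd' L2b.
apply/eqP/negPn/negP => g0.
have Px := inf_uniformizer cd' hb hx.
have yb : ordge P q%:Z (y - iota b) by right; rewrite (inf_tangency cd' hb hx).
have [G0 PG] := ordp_leading hb Px yb sG g0.
have := ordgeM (fX _ _ hb hx) (dvan _ _ hb yb).
rewrite e => /(ordge_neq0 G0); rewrite PG; have := cd_q cd; lia.
Qed.

(** Induction on the degree of the denominator: for a root [b] of it, [Y - b] divides every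
    coefficient of the numerator and is cancelled. *)
Lemma integral_rep f : pole_bounded f ->
  exists2 G : {poly {poly k}}, (size G <= q)%N & f = eval2 iota G x y.
Proof.
move=> hf; have [G [d [d0 sG e]]] := quotient_rep f.
have [n sd] := ubnP (size d); elim: n => // n IH in d G sd d0 sG e *.
have [s1|s1] := boolP (size d == 1%N).
  have /size_poly1P[a a0 ed] := s1.
  exists (a^-1%:P%:P * G).
    by rewrite mul_polyC (leq_trans (size_scale_leq _ _)).
  rewrite eval2M -e ed eval2C !map_polyC !hornerC /= fmorphV mulrC mulfK ?fmorph_eq0 //.
have /closed_rootP[b rb] := s1.
have eG := vanish_at_fiber hf sG rb e.
pose G1 := map_poly (fun h => h %/ ('X - b%:P)) G.
have eQ : G = ('X - b%:P)%:P * G1.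
  apply/polyP => i; rewrite coefCM coef_map_id0 ?div0p // mulrC divpK //.
  by rewrite dvdp_XsubCl; apply/eqP; have /polyP/(_ i) := eG; rewrite coef_map coef0.
have ed : d = (d %/ ('X - b%:P)) * ('X - b%:P) by rewrite divpK // dvdp_XsubCl.
apply: (IH (d %/ ('X - b%:P)) G1).
- move: sd; rewrite {1}ed size_mul ?polyXsubC_eq0 //; last first.
    by apply: contraNneq d0 => z; rewrite ed z mul0r.
  by rewrite size_XsubC addnS /= addn1 !ltnS.
- by apply: contraNneq d0 => z; rewrite ed z mul0r.
- by apply: leq_trans sG; apply: size_poly.
apply: (mulIf (y_sub_neq0 b)).
move: e; rewrite {1}ed eQ eval2M eval2C !rmorphM !rmorphB /= !map_polyX !map_polyC !hornerE.
by move=> e; rewrite e mulrC.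
Qed.

Theorem pole_bounded_span f : pole_bounded f -> exists a : 'I_4 -> k,
  f = \sum_i iota (a i) * [:: x; y; 1; x * y]`_i.
Proof.
move=> hf; have [G sG e] := integral_rep hf; have [fA fY fX] := hf.
have [f0|f0] := eqVneq f 0.
  by exists (fun=> 0); rewrite big1 // => i _; rewrite rmorph0 mul0r.
have G0 : G != 0 by apply: contraNneq f0 => z; rewrite e z eval2_0.
(* The degree in [Y]: the leading coefficient of [H] in [Y] has degree below [q] in [X], so it is
   nonzero at one of the [q] roots [a] of [L1]. At the pole of [y] over [a] the pole order of [f] is
   then the degree in [Y]. *)
have sY i : (size (G`_i)%R <= 2)%N.
  set H := swapXY G.
  have H0 : H != 0 by rewrite /H swapXY_eq0.
  have eH : f = eval2 iota H y x by rewrite eval2_swap.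
  suff sH : (size H <= 2)%N.
    apply/leq_sizeP => j hj; rewrite -coef_swapXY -/H [H`_j]nth_default ?coef0 //.
    exact: leq_trans sH hj.
  have [r [ur sr hr]] := separable_fiber 0 (cd_s1 cd) q0 (cd_d1 cd).
  have [a ar la] : exists2 a, a \in r & ~~ root (lead_coef H) a.
    apply/hasP; rewrite has_predC; apply/negP => al.
    have := max_poly_roots _ al ur; rewrite lead_coef_eq0 H0 sr => /(_ isT).
    rewrite ltnNge => /negP; apply; rewrite lead_coefE.
    apply: leq_trans sG; apply/leq_sizeP => j hj.
    by rewrite coef_swapXY [G`_j]nth_default ?coef0.
  have [P [ha hy]] := inf_exists cd (hr _ ar).
  have Py := inf_uniformizer cd ha hy.
  have [|h0 h] := has_value_neq0 (@has_value_leading _ _ _ P y x a (size H).-1 H ha Py _) la.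
    by move=> j; case/andP => h1 h2; exfalso; move: h1 h2; case: (size H) => //= n; lia.
  have y0 := coord_y_neq0 cd.
  move: h; rewrite -eH ordpM ?invr_eq0 ?expf_neq0 // ordpV ordpX Py mulNrn opprK.
  rewrite natz => h.
  have := ordge_neq0 f0 (fY _ _ ha hy); move: h; move: (P f) => m.
  by case: (size H) => //= n; lia.
(* The degree in [X]: a nonzero coefficient of [X ^ i] with [i >= 2] would vanish at the [q] roots
   of [L2], since otherwise [f] has a pole of order at least 2 there; but its degree in [Y] is at
   most 1, and [q > 1]. *)
have sX : (size G <= 2)%N.
  apply/leq_sizeP => i hi; apply/eqP/negPn/negP => Gi.
  have [r [ur sr hr]] := separable_fiber 0 (cd_s2 cd) q0 (cd_d2 cd).
  have : all (root G`_i) r.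
    apply/allP => b br; have [P [hb hx]] := inf_exists cd' (hr _ br).
    have Px := inf_uniformizer cd' hb hx.
    have yb : ordge P q%:Z (y - iota b) by right; rewrite (inf_tangency cd' hb hx).
    rewrite rootE; apply/negPn/negP => nr.
    have gi : (map_poly (horner_eval b) G)`_i = (G`_i).[b] by rewrite coef_map.
    have g0 : map_poly (horner_eval b) G != 0.
      by apply: contraNneq nr => z; rewrite -gi z coef0.
    have [_ PG] := ordp_leading hb Px yb sG g0.
    have := ordge_neq0 f0 (fX _ _ hb hx); rewrite e PG.
    have : (i < size (map_poly (horner_eval b) G))%N.
      by rewrite ltnNge; apply: contra nr => h; rewrite -gi nth_default.
    by case: (size _) => //= n; lia.
  move=> /(max_poly_roots Gi)/(_ ur); rewrite sr => h.
  by have := leq_trans h (sY i); have := cd_q cd; lia.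
exists (fun i => [:: G`_1`_0; G`_0`_1; G`_0`_0; G`_1`_1]`_i).
rewrite e (eval2_wide _ _ _ sX) !big_ord_recl !big_ord0 /= !addr0.
rewrite expr0 expr1 mulr1.
have h i : (map_poly iota G`_i).[y] = iota G`_i`_0 + iota G`_i`_1 * y.
  rewrite (@horner_coef_wide _ 2) ?size_map_poly // !big_ord_recl big_ord0 /=.
  by rewrite !coef_map expr0 mulr1 expr1 addr0.
by rewrite !h; ring.
Qed.

End RiemannRoch.

(** * Projective space, forms and their zero sets *)

Section Projective.
Variables (k : fieldType) (n : nat).
Implicit Types (L M : proj_pt k n) (v : 'rV[k]_n.+1).

Lemma val_hcoord L : val L = <[vpick (val L)]>%VS.
Proof.
have dL : \dim (val L) = 1%N by apply/eqP/(valP L).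
apply/eqP; rewrite eq_sym eqEdim dL -memvE memv_pick dim_vline vpick0.
by case: eqP dL => // ->; rewrite dimv0.
Qed.

Lemma hcoord_neq0 L : exists j, hcoord L j != 0.
Proof.
have : vpick (val L) != 0.
  by rewrite vpick0; apply/eqP => e; have := valP L; rewrite /= e dimv0.
by move=> /eqP/rowP h; apply/existsP; rewrite -negb_forall; apply/negP => /forallP z;
  apply: h => j; rewrite mxE; apply/eqP/z.
Qed.

Lemma hcoord_line L v : val L = <[v]>%VS -> exists2 s, s != 0 & forall i, v 0 i = s * hcoord L i.
Proof.
move=> e; have : v \in val L by rewrite e memv_line.
rewrite {1}val_hcoord => /vlineP[s es]; exists s; last by move=> i; rewrite es mxE.
apply: contraTneq (valP L) => s0.
by rewrite /= e es s0 scale0r dim_vline eqxx.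
Qed.

Lemma eq_proj L M s : (forall i, hcoord L i = s * hcoord M i) -> L = M.
Proof.
move=> h; have [j hj] := hcoord_neq0 L.
have s0 : s != 0 by apply: contraNneq hj => s0; rewrite h s0 mul0r.
apply: val_inj; rewrite val_hcoord [RHS]val_hcoord.
have -> : vpick (val L) = s *: vpick (val M) by apply/rowP => i; rewrite mxE; apply: h.
apply/eqP; rewrite eqEdim !dim_vline scaler_eq0 (negPf s0) /= leqnn andbT -memvE.
by apply/vlineP; exists s.
Qed.

End Projective.

Section HomogeneousEval.
Variables (k : fieldType) (R : comNzRingType) (f : {rmorphism k -> R}) (n : nat).
Implicit Types (h : {mpoly k[n]}) (g : 'I_n -> R).

Lemma mmap_homog d h g s : h \is d.-homog ->
  mmap f (fun i => s * g i) h = s ^+ d * mmap f g h.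
Proof.
move=> /dhomogP hd; rewrite /mmap mulr_sumr; apply: eq_big_seq => m /hd /= <-.
rewrite mulrCA; congr (_ * _); rewrite /mmap1 mdegE -prodrXr -big_split /=.
by apply: eq_bigr => i _; rewrite exprMn.
Qed.

Lemma mmapM g : {morph mmap f g : a b / a * b}.
Proof. by move=> a b; rewrite rmorphM. Qed.

Lemma mmapU g i : mmap f g 'X_i = g i.
Proof. by rewrite mmapX mmap1U. Qed.

Lemma mmap_pow g h i : mmap f g (h ^+ i) = mmap f g h ^+ i.
Proof. by rewrite rmorphXn. Qed.

End HomogeneousEval.

Lemma meval_mmap (k : fieldType) n (u : 'I_n -> k) h : h.@[u] = mmap idfun u h.
Proof. by []. Qed.

Lemma meval_homog (k : fieldType) n d (h : {mpoly k[n]}) (u : 'I_n -> k) s :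
  h \is d.-homog -> h.@[fun i => s * u i] = s ^+ d * h.@[u].
Proof. by move=> hd; apply: (mmap_homog idfun). Qed.

Lemma has_value_mmap (k K : fieldType) (iota : {rmorphism k -> K}) (P : place iota)
    n (g : 'I_n -> K) (u : 'I_n -> k) (h : {mpoly k[n]}) :
  (forall i, has_value P (g i) (u i)) -> has_value P (mmap iota g h) h.@[u].
Proof.
move=> hg; rewrite mevalE /mmap; apply: has_value_sum => m _.
apply: has_valueM; first exact: has_value_iota.
rewrite /mmap1; apply: big_ind2 => [|a b c d|i _]; first exact: has_value1.
  exact: has_valueM.
exact: has_valueX.
Qed.

(* The homogenization [X_j ^ q * L (X_i / X_j)]. *)
HB.lock Definition binary_form (k : fieldType) (n q : nat) (L : {poly k}) (i j : 'I_n) :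
    {mpoly k[n]} :=
  \sum_(r < q.+1) L`_r *: ('X_i ^+ r * 'X_j ^+ (q - r)).

Section BinaryForm.
Variables (k : fieldType) (n : nat) (q : nat) (L : {poly k}).
Hypothesis sL : size L = q.+1.
Implicit Types (i j : 'I_n).
Local Notation binary_form i j := (binary_form q L i j).

Lemma binary_form_homog i j : binary_form i j \is q.-homog.
Proof.
rewrite unlock; apply: rpred_sum => r _; apply: dhomogZ.
have X1 (l : 'I_n) e : ('X_l : {mpoly k[n]}) ^+ e \is e.-homog.
  by have := @dhomogMn n k mdeg 1 'X_l e; rewrite mul1n; apply; rewrite dhomogX /= mdeg1.
have := dhomogM (X1 i r) (X1 j (q - r)%N); rewrite subnKC //.
by rewrite -ltnS.
Qed.

Lemma mmap_binary_form (R : fieldType) (f : {rmorphism k -> R}) (g : 'I_n -> R) i j :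
  mmap f g (binary_form i j) = \sum_(r < q.+1) f L`_r * (g i ^+ r * g j ^+ (q - r)).
Proof.
rewrite unlock raddf_sum /=; apply: eq_bigr => r _.
by rewrite mmapZ mmapM !mmap_pow !mmapU.
Qed.

Lemma mmap_binary_form_finite (R : fieldType) (f : {rmorphism k -> R}) (g : 'I_n -> R) i j :
  g j != 0 ->
  mmap f g (binary_form i j) = g j ^+ q * (map_poly f L).[g i / g j].
Proof.
move=> gj; rewrite mmap_binary_form (@horner_coef_wide _ q.+1) ?size_map_poly ?sL //.
rewrite mulr_sumr; apply: eq_bigr => r _; rewrite coef_map [RHS]mulrCA expr_div_n; congr (_ * _).
by rewrite [RHS]mulrCA expfB_cond // (negPf gj) add0n -ltnS.
Qed.

Lemma mmap_binary_form_infinite (R : fieldType) (f : {rmorphism k -> R}) (g : 'I_n -> R) i j :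
  g j = 0 -> mmap f g (binary_form i j) = f (lead_coef L) * g i ^+ q.
Proof.
move=> gj; rewrite mmap_binary_form big_ord_recr /= subnn expr0 mulr1 big1 ?add0r.
  by rewrite lead_coefE sL.
by move=> r _; rewrite gj expr0n subn_eq0 leqNgt ltn_ord /= !mulr0.
Qed.

End BinaryForm.

Local Open Scope classical_set_scope.

Lemma proj_open_neq0 (k : fieldType) n (A : {mpoly k[n.+1]}) d : A \is d.-homog ->
  proj_open [set L : proj_pt k n | A.@[hcoord L] != 0].
Proof.
move=> hA; exists [set A]; first by move=> h ->; exists d.
apply/seteqP; split=> L /=; first by move=> /negP/negPn/eqP e h ->.
by move=> h; rewrite h // eqxx.
Qed.

(** A product of linear forms, one for each point [L] of [s], which vanishes at [L] and not at
    [M]. *)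
Lemma proj_separate (k : fieldType) n (s : seq (proj_pt k n)) (M : proj_pt k n) :
  ~ List.In M s -> exists d (h : {mpoly k[n.+1]}),
    [/\ h \is d.-homog, h.@[hcoord M] != 0 & forall L, List.In L s -> h.@[hcoord L] = 0].
Proof.
elim: s => [|L s IH] Ms.
  by exists 0%N, 1; split; rewrite ?dhomog1 ?meval1 ?oner_neq0.
have [|d [h [hd hM hs]]] := IH; first by move=> i; apply: Ms; right.
(* If all these minors vanish, the coordinate vectors are proportional and [L = M]. *)
have [i [j ij]] : exists i j, hcoord L i * hcoord M j - hcoord L j * hcoord M i != 0.
  have [j Mj] := hcoord_neq0 M; apply: contrapT => H; apply: Ms; left.
  apply: (@eq_proj _ _ _ _ (hcoord L j / hcoord M j)) => i; apply/eqP/negPn/negP => ne.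
  apply: H; exists i, j; apply: contra ne; rewrite subr_eq0 => /eqP e.
  by rewrite mulrAC -e mulfK.
exists (1 + d)%N, ((hcoord L i *: 'X_j - hcoord L j *: 'X_i) * h); split.
- apply: dhomogM => //; apply: rpredB; apply: dhomogZ; by rewrite dhomogX /= mdeg1.
- by rewrite mevalM mevalB !mevalZ !mevalXU mulf_neq0.
- move=> N /= [<-|Ns]; rewrite mevalM mevalB !mevalZ !mevalXU; last by rewrite hs ?mulr0.
  by rewrite [X in _ - X]mulrC subrr mul0r.
Qed.

Lemma proj_open_cofinite (k : fieldType) n (S : set (proj_pt k n)) :
  finite_set S -> proj_open (~` S).
Proof.
move=> fS; have [s es] : exists s, S = [set L | List.In L s].
  have /(@finite_seqP {classic (proj_pt k n)})[s es] := fS.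
  exists s; rewrite es; apply/seteqP; split=> L /=.
    elim: s {es} => //= a s IH; rewrite inE => /orP[/eqP ->|/IH]; first by left.
    by right.
  elim: s {es} => //= a s IH [->|/IH h]; rewrite inE; first by rewrite eqxx.
  by rewrite h orbT.
exists [set h | (exists d, h \is d.-homog) /\ forall L, S L -> h.@[hcoord L] = 0].
  by move=> h [].
rewrite setCK; apply/seteqP; split=> M /=; first by move=> SM h [_]; apply.
move=> hM; apply: contrapT; rewrite {1}es => /proj_separate[d [h [hd hM0 hs]]].
move/eqP: hM0; apply; apply: hM; split; first by exists d.
by rewrite es.
Qed.

Local Close Scope classical_set_scope.

(** * The map to projective space: its values and its injectivity *)

Definition i0 : 'I_4 := @Ordinal 4 0 isT.
Definition i1 : 'I_4 := @Ordinal 4 1 isT.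
Definition i2 : 'I_4 := @Ordinal 4 2 isT.
Definition i3 : 'I_4 := @Ordinal 4 3 isT.

Lemma ord4P (A : 'I_4 -> Prop) : A i0 -> A i1 -> A i2 -> A i3 -> forall i, A i.
Proof.
move=> h0 h1 h2 h3 [[|[|[|[|i]]]] hi] //.
- by rewrite (_ : Ordinal hi = i0) //; apply: val_inj.
- by rewrite (_ : Ordinal hi = i1) //; apply: val_inj.
- by rewrite (_ : Ordinal hi = i2) //; apply: val_inj.
- by rewrite (_ : Ordinal hi = i3) //; apply: val_inj.
Qed.

Definition segre (K : fieldType) (x y : K) (i : 'I_4) : K := [:: x; y; 1; x * y]`_i.

Definition row4 (k : fieldType) (a0 a1 a2 a3 : k) : 'rV[k]_4 :=
  \row_i [:: a0; a1; a2; a3]`_i.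

Section Map.
Variables (k : closedFieldType) (K : fieldType) (iota : {rmorphism k -> K}) (x y : K).
Variables (L1 L2 : {poly k}) (c : k) (q : nat).
Hypothesis cd : curve_data iota x y L1 L2 c q.
Variable phi : smooth_model iota -> Proj k 3.
Hypothesis phi_mor : morphism phi.
Local Notation f := (segre x y).
Hypothesis phi_ext : extends_rational_map f phi.
Let cd' := curve_data_swap cd.
Local Notation u P := (hcoord (phi P)).
Implicit Types (P Q : place iota).

Let x0 : x != 0 := coord_y_neq0 cd'.
Let y0 : y != 0 := coord_y_neq0 cd.

Lemma segre_neq0 i : f i != 0.
Proof. by elim/ord4P: i; rewrite /segre /= ?oner_neq0 ?mulf_neq0. Qed.

Local Open Scope classical_set_scope.

(** The pullback [g] of [X_i / X_j] is an element of [K]. At the affine places where [X_j] is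
    nonzero it has the same values as [f i / f j], hence the two are equal, and the poles of [x] and
    [y] are covered too. *)
Lemma ratio_value P i j : u P j != 0 -> has_value P (f i / f j) (u P i / u P j).
Proof.
move=> uj; pose V := [set L : Proj k 3 | hcoord L j != 0].
have XX (l : 'I_4) : ('X_l : {mpoly k[4]}) \is 1.-homog by rewrite dhomogX /= mdeg1.
have oV : opens V.
  have := proj_open_neq0 (XX j); congr proj_open.
  by apply/seteqP; split=> L /=; rewrite mevalXU.
pose h (L : Proj k 3) := hcoord L i / hcoord L j.
have rV : regular V h.
  move=> L VL; exists V, 1%N, 'X_i, 'X_j; split=> //.
  by move=> M VM; rewrite !mevalXU.
have [oU /(_ _ rV)[g hg]] := phi_mor oV.
set U := _ @^-1` V in oU hg.
have UP : U P by [].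
have fU : finite_set (~` U).
  by case: oU => // e; move: UP; rewrite e.
pose inf : set (place iota) := [set Q | has_value Q y^-1 0] `|` [set Q | has_value Q x^-1 0].
have finf : finite_set inf.
  by rewrite finite_setU; split; [apply: (finite_poles_y cd)|apply: (finite_poles_y cd')].
have eg : g = f i / f j.
  apply: (@eq_of_cofinite _ _ _ _ _ _ _ _ _ cd (U `\` inf) g (f i / f j)
            (fun Q => h (phi Q))).
  - by rewrite setCD finite_setU.
  - by move=> Q [UQ _]; apply: hg.
  move=> Q [UQ]; case: (place_classify cd Q) => [a b ha hb|a ha hb|b hb ha] ninf; first last.
  - by case: ninf; right.
  - by case: ninf; left.
  pose v : 'rV[k]_4 := row4 a b 1 (a * b).
  have hv l : has_value Q (f l) (v 0 l).
    rewrite mxE; elim/ord4P: l; rewrite /segre //=; first exact: has_value1.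
    exact: has_valueM.
  have v0 : v != 0.
    by apply/eqP => /rowP/(_ i2); rewrite !mxE /= => /eqP; rewrite oner_eq0.
  have [s s0 es] := hcoord_line (phi_ext hv v0).
  have -> : h (phi Q) = v 0 i / v 0 j.
    by rewrite !es /h -mulf_div divff // mul1r.
  by apply: has_value_div => //; rewrite es mulf_neq0.
by have := hg _ UP; rewrite eg.
Qed.

(** The factor [w] clears the poles of the [f i] at [P]: it will be [1], [1 / y] or [1 / x],
    according to the kind of place. *)
Lemma phi_line P w (v : 'rV[k]_4) : (forall i, has_value P (f i * w) (v 0 i)) ->
  exists s, forall i, v 0 i = s * u P i.
Proof.
move=> hv; have [j hj] := hcoord_neq0 (phi P).
exists (v 0 j / u P j) => i; rewrite mulrAC -mulrA mulrC.
apply: (@has_value_uniq _ _ _ P (f i * w)) => //.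
have -> : f i * w = (f i / f j) * (f j * w) by rewrite mulrA divfK ?segre_neq0.
by apply: has_valueM => //; apply: ratio_value.
Qed.

Lemma homog_value P j d (h : {mpoly k[4]}) : u P j != 0 -> h \is d.-homog ->
  has_value P (mmap iota f h / f j ^+ d) (h.@[u P] / u P j ^+ d).
Proof.
move=> uj hd; have := has_value_mmap h (fun i => @ratio_value P i j uj).
have -> : (fun i => f i / f j) = (fun i => (f j)^-1 * f i) by apply/funext => i; rewrite mulrC.
have -> : (fun i => u P i / u P j) = (fun i => (u P j)^-1 * u P i) by apply/funext => i; rewrite mulrC.
rewrite (mmap_homog _ _ _ hd) (meval_homog _ _ hd) !exprVn.
by rewrite ![_^-1 * _]mulrC.
Qed.

Lemma coord_affine P a b : has_value P x a -> has_value P y b ->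
  exists s, forall i, row4 a b 1 (a * b) 0 i = s * u P i.
Proof.
move=> ha hb; apply: (@phi_line P 1) => i; rewrite mulr1 mxE.
by elim/ord4P: i; rewrite /segre //=; [apply: has_value1|apply: has_valueM].
Qed.

Lemma coord_infY P a : has_value P x a -> has_value P y^-1 0 ->
  exists s, forall i, row4 0 1 0 a 0 i = s * u P i.
Proof.
move=> ha hb; apply: (@phi_line P y^-1) => i; rewrite mxE.
elim/ord4P: i; rewrite /segre /=.
- by rewrite -(mulr0 a); apply: has_valueM.
- by rewrite divff //; apply: has_value1.
- by rewrite mul1r.
- by rewrite mulfK.
Qed.

Lemma coord_infX P b : has_value P y b -> has_value P x^-1 0 ->
  exists s, forall i, row4 1 0 0 b 0 i = s * u P i.
Proof.
move=> hb ha; apply: (@phi_line P x^-1) => i; rewrite mxE.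
elim/ord4P: i; rewrite /segre /=.
- by rewrite divff //; apply: has_value1.
- by rewrite -(mulr0 b); apply: has_valueM.
- by rewrite mul1r.
- by rewrite mulrAC divff // mul1r.
Qed.

(** The functions [x], [y], [1 / x], [1 / y] are ratios of the [f i], so their values can be read
    off from the image. The coordinate [X_2] is nonzero for affine places, [X_0] for poles of [x],
    [X_1] for poles of [y]. *)
Lemma phi_inj : injective phi.
Proof.
move=> P Q e; have rP i j := @ratio_value P i j; have rQ i j := @ratio_value Q i j.
rewrite -e in rQ.
have x20 : f i0 / f i2 = x by rewrite /segre /= divr1.
have y21 : f i1 / f i2 = y by rewrite /segre /= divr1.
have x31 : f i3 / f i1 = x by rewrite /segre /= mulfK.
have y30 : f i3 / f i0 = y by rewrite /segre /= mulrAC divff ?mul1r.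
have y12 : f i2 / f i1 = y^-1 by rewrite /segre /= mul1r.
have x02 : f i2 / f i0 = x^-1 by rewrite /segre /= mul1r.
have y03 : f i0 / f i3 = y^-1 by rewrite /segre /= invfM mulrA divff ?mul1r.
have x13 : f i1 / f i3 = x^-1 by rewrite /segre /= invfM mulrCA divff ?mulr1.
have [u2|u2] := eqVneq (u P i2) 0; last first.
  apply: (affine_uniq cd (a := u P i0 / u P i2) (b := u P i1 / u P i2)).
  - by rewrite -{1}x20; apply: rP.
  - by rewrite -{1}y21; apply: rP.
  - by rewrite -{1}x20; apply: rQ.
  - by rewrite -{1}y21; apply: rQ.
have [u0|u0] := eqVneq (u P i0) 0; last first.
  apply: (inf_uniq cd' (a := u P i3 / u P i0)).
  - by rewrite -{1}y30; apply: rP.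
  - by have := rP i2 _ u0; rewrite u2 mul0r x02.
  - by rewrite -{1}y30; apply: rQ.
  - by have := rQ i2 _ u0; rewrite u2 mul0r x02.
have [u1|u1] := eqVneq (u P i1) 0; last first.
  apply: (inf_uniq cd (a := u P i3 / u P i1)).
  - by rewrite -{1}x31; apply: rP.
  - by have := rP i2 _ u1; rewrite u2 mul0r y12.
  - by rewrite -{1}x31; apply: rQ.
  - by have := rQ i2 _ u1; rewrite u2 mul0r y12.
(* Only [X_3] is left; the point [(0 : 0 : 0 : 1)] would be a common pole of [x] and [y]. *)
have u3 : u P i3 != 0.
  have [j] := hcoord_neq0 (phi P); apply: contraNneq => u3.
  by move: j; apply: ord4P; apply/eqP.
case: (no_double_pole cd (P := P)).
  by have := rP i1 _ u3; rewrite u1 mul0r x13.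
by have := rP i0 _ u3; rewrite u0 mul0r y03.
Qed.

End Map.

(** * The image is closed, and the map is an isomorphism onto it *)

Section Embedding.
Variables (k : closedFieldType) (K : fieldType) (iota : {rmorphism k -> K}) (x y : K).
Variables (L1 L2 : {poly k}) (c : k) (q : nat).
Hypothesis cd : curve_data iota x y L1 L2 c q.
Variable phi : smooth_model iota -> Proj k 3.
Hypothesis phi_mor : morphism phi.
Hypothesis phi_ext : extends_rational_map (segre x y) phi.
Let cd' := curve_data_swap cd.
Local Notation f := (segre x y).
Local Notation u P := (hcoord (phi P)).
Implicit Types (P Q : place iota).
Local Open Scope classical_set_scope.

Let x0 : x != 0 := coord_y_neq0 cd'.
Let y0 : y != 0 := coord_y_neq0 cd.
Let s1 := cd_s1 cd.
Let s2 := cd_s2 cd.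

Lemma homog_vanish P d (h : {mpoly k[4]}) : h \is d.-homog ->
  mmap iota f h = 0 -> h.@[u P] = 0.
Proof.
move=> hd e; have [j uj] := hcoord_neq0 (phi P).
have := homog_value cd phi_mor phi_ext uj hd.
rewrite e mul0r => /has_value_uniq/(_ (has_value_zero _))/eqP.
by rewrite mulf_eq0 invr_eq0 expf_eq0 (negPf uj) andbF orbF => /eqP.
Qed.

(* Bihomogeneous in [(X_i : X_j)] and [(X_l : X_m)], which are the two
   coordinates [x] and [y] of the quadric [X_0 X_1 = X_2 X_3] in suitable charts. *)
Definition curve_form (i j l m : 'I_4) : {mpoly k[4]} :=
  binary_form q L1 i j * binary_form q L2 l m + c *: ('X_j * 'X_m) ^+ q.

Lemma curve_form_homog i j l m : curve_form i j l m \is (q + q).-homog.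
Proof.
apply: rpredD; first by apply: dhomogM; apply: binary_form_homog.
apply: dhomogZ; have X1 (a : 'I_4) : ('X_a : {mpoly k[4]}) \is 1.-homog.
  by rewrite dhomogX /= mdeg1.
by rewrite addnn -mul2n; apply: (dhomogMn q (dhomogM (X1 j) (X1 m))).
Qed.

Lemma mmap_curve_form (R : fieldType) (g : {rmorphism k -> R}) (w : 'I_4 -> R) i j l m :
  mmap g w (curve_form i j l m) =
  mmap g w (binary_form q L1 i j) * mmap g w (binary_form q L2 l m)
  + g c * (w j * w m) ^+ q.
Proof. by rewrite mmapD mmapZ !mmapM mmap_pow mmapM !mmapU. Qed.

Lemma curve_form_vanish i j l m : f j != 0 -> f m != 0 ->
  f i / f j = x -> f l / f m = y -> mmap iota f (curve_form i j l m) = 0.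
Proof.
move=> fj fm ex ey; rewrite mmap_curve_form.
rewrite (mmap_binary_form_finite s1 iota _ fj).
rewrite (mmap_binary_form_finite s2 iota _ fm) ex ey.
rewrite mulrACA (curve_eqn cd) exprMn mulrN [iota c * _]mulrC addNr //.
Qed.

(** The quadric and four instances of [curve_form] suffice, one for each chart of the quadric. *)
Lemma mem_range (L : Proj k 3) :
  (forall d h, h \is d.-homog -> mmap iota f h = 0 -> h.@[hcoord L] = 0) ->
  range phi L.
Proof.
move=> hL; set w := hcoord L in hL.
have quad : w i0 * w i1 = w i2 * w i3.
  have X1 (a : 'I_4) : ('X_a : {mpoly k[4]}) \is 1.-homog by rewrite dhomogX /= mdeg1.
  have := hL (1 + 1)%N ('X_i0 * 'X_i1 - 'X_i2 * 'X_i3) (rpredB (dhomogM (X1 _) (X1 _)) (dhomogM (X1 _) (X1 _))).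
  rewrite mmapB !mmapM !mmapU mevalB !mevalM !mevalXU /segre /= mul1r subrr.
  by move=> /(_ erefl)/eqP; rewrite subr_eq0 => /eqP.
have cf i j l m : f j != 0 -> f m != 0 -> f i / f j = x -> f l / f m = y ->
    mmap idfun w (binary_form q L1 i j) * mmap idfun w (binary_form q L2 l m)
    + c * (w j * w m) ^+ q = 0.
  move=> fj fm ex ey; have := hL _ _ (curve_form_homog i j l m) (curve_form_vanish fj fm ex ey).
  by rewrite meval_mmap mmap_curve_form.
have fn := segre_neq0 cd.
have map_id (g : {poly k}) : map_poly idfun g = g by rewrite map_poly_id.
have lc1 : lead_coef L1 != 0 by rewrite lead_coef_eq0 -size_poly_eq0 s1.
have lc2 : lead_coef L2 != 0 by rewrite lead_coef_eq0 -size_poly_eq0 s2.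
have q0 : (0 < q)%N := ltnW (cd_q cd).
have conclude P (v : 'rV[k]_4) t : (exists s, forall i, v 0 i = s * u P i) ->
    t != 0 -> (forall i, v 0 i = w i / t) -> range phi L.
  move=> [s es] t0 et; exists P => //; apply/esym.
  apply: (@eq_proj _ _ _ _ (t * s)) => i.
  by rewrite -mulrA -es et mulrC divfK.
have E02 : f i0 / f i2 = x by rewrite /segre /= divr1.
have E12 : f i1 / f i2 = y by rewrite /segre /= divr1.
have E31 : f i3 / f i1 = x by rewrite /segre /= mulfK.
have E30 : f i3 / f i0 = y by rewrite /segre /= mulrAC divff ?mul1r.
have [u2|u2] := eqVneq (w i2) 0; last first.
  have := cf i0 i2 i1 i2 (fn _) (fn _) E02 E12.
  rewrite !mmap_binary_form_finite // !map_id mulrACA exprMn [c * _]mulrC -mulrDr => /eqP.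
  rewrite mulf_eq0 mulf_eq0 expf_eq0 (negPf u2) andbF /= => /eqP e.
  have [P [ha hb]] := affine_exists cd e.
  apply: (conclude P _ (w i2) (coord_affine cd phi_mor phi_ext ha hb) u2) => i.
  rewrite mxE; elim/ord4P: i; rewrite /= ?divff //.
  by rewrite mulf_div quad -mulf_div divff // mul1r.
have [u0|u0] := eqVneq (w i0) 0; last first.
  have u1 : w i1 = 0.
    by move/eqP: quad; rewrite u2 mul0r mulf_eq0 (negPf u0) => /eqP.
  (* With [X_2 = 0] the form of [L1] reduces to its leading term in [X_0], so [X_3 / X_0] is a root
     of [L2] and the point comes from a pole of [x]. *)
  have := cf i0 i2 i3 i0 (fn _) (fn _) E02 E30.
  rewrite (mmap_binary_form_infinite s1) // (mmap_binary_form_finite s2) // map_id u2 mul0r.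
  rewrite expr0n eqn0Ngt q0 mulr0 addr0 /= => /eqP.
  rewrite !mulf_eq0 !expf_eq0 (negPf u0) (negPf lc1) !andbF /= => /eqP e.
  have [P [hb ha]] := inf_exists cd' e.
  apply: (conclude P _ (w i0) (coord_infX cd phi_mor phi_ext hb ha) u0) => i.
  by rewrite mxE; elim/ord4P: i; rewrite /= ?divff // ?u1 ?u2 mul0r.
have [u1|u1] := eqVneq (w i1) 0; last first.
  have := cf i3 i1 i1 i2 (fn _) (fn _) E31 E12.
  rewrite (mmap_binary_form_infinite s2) // (mmap_binary_form_finite s1) // map_id u2 mulr0.
  rewrite expr0n eqn0Ngt q0 mulr0 addr0 /= => /eqP.
  rewrite !mulf_eq0 !expf_eq0 (negPf u1) (negPf lc2) !andbF /= orbF => /eqP e.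
  have [P [ha hb]] := inf_exists cd e.
  apply: (conclude P _ (w i1) (coord_infY cd phi_mor phi_ext ha hb) u1) => i.
  by rewrite mxE; elim/ord4P: i; rewrite /= ?divff // ?u0 ?u2 mul0r.
have u3 : w i3 != 0.
  have [j] := hcoord_neq0 L; apply: contraNneq => u3.
  by move: j; apply: ord4P; apply/eqP.
(* At [(0 : 0 : 0 : 1)] this form is a product of leading coefficients and powers of [X_3], so it
   does not vanish. *)
have := cf i3 i1 i3 i0 (fn _) (fn _) E31 E30.
rewrite !mmap_binary_form_infinite // u0 mulr0 expr0n eqn0Ngt q0 mulr0 addr0 => /eqP.
by rewrite !mulf_eq0 !expf_eq0 (negPf u3) (negPf lc1) (negPf lc2) !andbF.
Qed.

Lemma range_closed : @opens k (Proj k 3) (~` range phi).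
Proof.
exists [set h | (exists d, h \is d.-homog) /\ mmap iota f h = 0]; first by move=> h [].
rewrite setCK; apply/seteqP; split=> L /=.
  by move=> [P _ <-] h [[d hd] e]; apply: homog_vanish hd e.
by move=> hL; apply: mem_range => d h hd e; apply: hL; split=> //; exists d.
Qed.

(** Near [P], [z] is the pullback of the function [A / B], which is regular at the image of [P]. *)
Definition homog_fraction P (z : K) := exists d (A B : {mpoly k[4]}),
  [/\ A \is d.-homog, B \is d.-homog, B.@[u P] != 0 &
      z * mmap iota f B = mmap iota f A].

Lemma homog_fraction_iota P a : homog_fraction P (iota a).
Proof.
exists 0%N, (a *: 1), 1; split; rewrite ?dhomogZ ?dhomog1 ?meval1 ?oner_neq0 //.
by rewrite mmapZ.
Qed.

Lemma homog_fractionD P z w : homog_fraction P z -> homog_fraction P w ->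
  homog_fraction P (z + w).
Proof.
move=> [d [A [B [hA hB B0 e]]]] [d' [A' [B' [hA' hB' B0' e']]]].
exists (d + d')%N, (A * B' + B * A'), (B * B'); split.
- by apply: rpredD; apply: dhomogM.
- exact: dhomogM.
- by rewrite mevalM mulf_neq0.
- by rewrite mmapD !mmapM -e -e'; ring.
Qed.

Lemma homog_fractionM P z w : homog_fraction P z -> homog_fraction P w ->
  homog_fraction P (z * w).
Proof.
move=> [d [A [B [hA hB B0 e]]]] [d' [A' [B' [hA' hB' B0' e']]]].
exists (d + d')%N, (A * A'), (B * B'); split; rewrite ?mevalM ?mulf_neq0 ?dhomogM //.
by rewrite !mmapM -e -e' mulrACA.
Qed.

Lemma homog_fraction_coord P i j : u P j != 0 -> homog_fraction P (f i / f j).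
Proof.
move=> uj; exists 1%N, 'X_i, 'X_j; split; rewrite ?dhomogX ?mevalXU //= ?mdeg1 //.
by rewrite !mmapU divfK ?(segre_neq0 cd).
Qed.

(** Comparing values in [z * B = A] shows that [A] does not vanish at the image of [P]. *)
Lemma homog_fractionV P z v : homog_fraction P z -> has_value P z v -> v != 0 ->
  homog_fraction P z^-1.
Proof.
move=> [d [A [B [hA hB B0 e]]]] hz v0; have [z0 _] := has_value_neq0 hz v0.
exists d, B, A; split=> //; last by rewrite -e mulKf.
have [j uj] := hcoord_neq0 (phi P).
have ha := homog_value cd phi_mor phi_ext uj hA.
have hb := homog_value cd phi_mor phi_ext uj hB.
have := has_valueM hz hb; rewrite mulrA e => /has_value_uniq/(_ ha) E.
apply: contraNneq B0 => A0; move/eqP: E; rewrite A0 mul0r.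
by rewrite !mulf_eq0 invr_eq0 expf_eq0 (negPf uj) (negPf v0) andbF orbF.
Qed.

Lemma homog_fraction_eval2 P s t G : homog_fraction P s -> homog_fraction P t ->
  homog_fraction P (eval2 iota G s t).
Proof.
move=> hs ht; elim/poly_ind: G => [|G d IH].
  by rewrite eval2_0 -(rmorph0 iota); apply: homog_fraction_iota.
rewrite eval2D eval2M eval2X eval2C; apply: homog_fractionD.
  exact: homog_fractionM.
elim/poly_ind: d => [|d a IHd].
  by rewrite rmorph0 horner0 -(rmorph0 iota); apply: homog_fraction_iota.
rewrite rmorphD rmorphM /= map_polyX map_polyC !hornerE.
by apply: homog_fractionD (homog_fraction_iota _ _); apply: homog_fractionM.
Qed.

(** The map of local rings is surjective: [z] is a fraction in the two coordinates of a chart at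
    [P], and these are ratios [X_i / X_j] with [X_j] nonzero at the image. *)
Lemma local_homog_fraction P z v : has_value P z v -> homog_fraction P z.
Proof.
have chart s t a b A B : has_value P s a -> has_value P t b ->
    homog_fraction P s -> homog_fraction P t -> B.[a%:P].[b] != 0 ->
    homog_fraction P (eval2 iota A s t / eval2 iota B s t).
  move=> ha hb hs ht B0; apply: homog_fractionM; first exact: homog_fraction_eval2.
  by apply: homog_fractionV (has_value_eval2 B ha hb) B0; apply: homog_fraction_eval2.
have coord_neq0 (w : 'rV[k]_4) j : (exists s, forall i, w 0 i = s * u P i) ->
    w 0 j = 1 -> u P j != 0.
  move=> [s es] w1; apply/negP => /eqP u0; move: w1; rewrite es u0 mulr0 => /eqP.
  by rewrite eq_sym oner_eq0.
move=> hz; case: (place_classify cd P) => [a b ha hb|a ha hb|b hb ha].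
- have [A [B [B0 ->]]] := affine_fraction cd ha hb hz.
  have u2 : u P i2 != 0.
    by apply: coord_neq0 (coord_affine cd phi_mor phi_ext ha hb) _; rewrite mxE.
  apply: chart ha hb _ _ B0.
    by have := homog_fraction_coord i0 u2; rewrite /segre /= divr1.
  by have := homog_fraction_coord i1 u2; rewrite /segre /= divr1.
- have [A [B [B0 ->]]] := inf_fraction cd ha hb hz.
  have u1 : u P i1 != 0.
    by apply: coord_neq0 (coord_infY cd phi_mor phi_ext ha hb) _; rewrite mxE.
  apply: chart ha hb _ _ B0.
    by have := homog_fraction_coord i3 u1; rewrite /segre /= mulfK.
  by have := homog_fraction_coord i2 u1; rewrite /segre /= mul1r.
- have [A [B [B0 ->]]] := inf_fraction cd' hb ha hz.
  have u0 : u P i0 != 0.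
    by apply: coord_neq0 (coord_infX cd phi_mor phi_ext hb ha) _; rewrite mxE.
  apply: chart hb ha _ _ B0.
    by have := homog_fraction_coord i3 u0; rewrite /segre /= mulrAC divff // mul1r.
  by have := homog_fraction_coord i2 u0; rewrite /segre /= mul1r.
Qed.

(** A regular function on the image is only locally a restriction from projective space, so it pulls
    back locally to elements of [K]. Any two of these have equal values at cofinitely many places
    and thus coincide. *)
Lemma morphism_corestrict :
  @morphism k (smooth_model iota) (subvariety (range phi)) (corestrict phi).
Proof.
move=> V [V' oV' eV]; have [oU _] := phi_mor oV'.
have eU : corestrict phi @^-1` V = phi @^-1` V' by rewrite eV.
split; first by rewrite eU.
move=> h hh; rewrite eU.
have loc P : (phi @^-1` V') P -> exists W (g : K), [/\ place_open W, W P &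
    forall Q, W Q -> has_value Q g (h (corestrict phi Q))].
  move=> VP; have VP' : V (corestrict phi P) by rewrite eV.
  have [V1 [h1 [oV1 V1P rh1 e1]]] := hh _ VP'.
  have [oW1 /(_ _ rh1)[g hg]] := phi_mor oV1.
  have oI : place_open (phi @^-1` V1 `&` phi @^-1` V').
    case: oW1 => [e|f1]; first by move: V1P; rewrite -[V1 _]/((phi @^-1` V1) P) e.
    case: oU => [e|f2]; first by move: VP; rewrite e.
    by right; rewrite setCI finite_setU.
  exists (phi @^-1` V1 `&` phi @^-1` V'), g; split=> // Q [V1Q VQ].
  by rewrite e1 //; [apply: hg|rewrite eV].
(* On the empty set every element of [K] serves, for instance 0. *)
have [[P0 VP0]|none] := pselect (exists P, (phi @^-1` V') P); last first.
  by exists 0 => P VP; case: none; exists P.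
have [W0 [g0 [oW0 W0P h0]]] := loc _ VP0.
exists g0 => P VP; have [W [g [oW WP hg]]] := loc _ VP.
suff -> : g0 = g by apply: hg.
apply: (@eq_of_cofinite _ _ _ _ _ _ _ _ _ cd (W0 `&` W) g0 g
         (fun Q => h (corestrict phi Q))).
- rewrite setCI finite_setU; split.
    by case: oW0 => // e; move: W0P; rewrite e.
  by case: oW => // e; move: WP; rewrite e.
- by move=> Q [WQ _]; apply: h0.
- by move=> Q [_ WQ]; apply: hg.
Qed.

Lemma embedding_phi : embedding phi.
Proof.
split; first exact: range_closed.
have inj := phi_inj cd phi_mor phi_ext.
pose g (z : subvariety (range phi)) : smooth_model iota := s2val (cid2 (proj2_sig z)).
have gK (z : subvariety (range phi)) : phi (g z) = proj1_sig z.
  by rewrite /g; case: cid2.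
exists g; split; last 1 first.
- move=> V oV; split.
    case: oV => [->|fV].
      exists set0; last by apply/seteqP; split.
      by exists set0; [|apply/seteqP; split=> // L _ []].
    (* The image of the finite complement of [V] is finite, hence closed; by injectivity its
       complement cuts out [V] on the image. *)
    exists (~` (phi @` (~` V))).
      by apply: proj_open_cofinite; apply: finite_image.
    apply/seteqP; split=> z /=; rewrite -gK.
      by move=> Vz [Q nVQ /inj e]; apply: nVQ; rewrite e.
    by move=> h; apply: contrapT => nV; apply: h; exists (g z).
  move=> h [z hz] w Vw.
  have [d [A [B [hA hB B0 e]]]] := local_homog_fraction (hz _ Vw).
  exists [set L : Proj k 3 | B.@[hcoord L] != 0].
  exists (fun L => A.@[hcoord L] / B.@[hcoord L]); split.
  + exact: proj_open_neq0 hB.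
  + by rewrite /= -gK.
  + move=> L BL; exists [set L : Proj k 3 | B.@[hcoord L] != 0], d, A, B; split=> //.
    exact: proj_open_neq0 hB.
  (* The identity [z * B = A] in [K] determines the value of [z] at every place where [B] is
     nonzero. *)
  move=> w' Vw' /=; rewrite -gK => Bw'.
  have [j uj] := hcoord_neq0 (phi (g w')).
  have ha := homog_value cd phi_mor phi_ext uj hA.
  have hb := homog_value cd phi_mor phi_ext uj hB.
  have := has_valueM (hz _ Vw') hb; rewrite mulrA e => /has_value_uniq/(_ ha).
  rewrite mulrA => /mulIf E; rewrite -E ?mulfK //.
  by rewrite invr_eq0 expf_neq0.
- by move=> P; apply: inj; rewrite gK.
- by move=> z; apply: (eq_sig_hprop (fun _ => @Prop_irrelevance _)); apply: gK.
- exact: morphism_corestrict.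
Qed.

End Embedding.

(** * Hyperplane sections and completeness *)

Lemma sum_ord4 (V : nmodType) (F : 'I_4 -> V) :
  \sum_i F i = F i0 + F i1 + F i2 + F i3.
Proof.
rewrite !big_ord_recr big_ord0 /= add0r.
by congr (F _ + F _ + F _ + F _); apply: val_inj.
Qed.

Section LinearSystem.
Variables (k : closedFieldType) (K : fieldType) (iota : {rmorphism k -> K}) (x y : K).
Variables (L1 L2 : {poly k}) (c : k) (q : nat).
Hypothesis cd : curve_data iota x y L1 L2 c q.
Variable phi : smooth_model iota -> Proj k 3.
Hypothesis phi_mor : morphism phi.
Hypothesis phi_ext : extends_rational_map (segre x y) phi.
Let cd' := curve_data_swap cd.
Local Notation f := (segre x y).
Local Notation u P := (hcoord (phi P)).
Implicit Types (P Q : place iota) (a : 'rV[k]_4).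
Local Open Scope classical_set_scope.

Let ratio P i j := @ratio_value _ _ _ _ _ _ _ _ _ cd phi phi_mor phi_ext P i j.
Let fn := segre_neq0 cd.

Definition linear_fun a : K := \sum_i iota (a 0 i) * f i.

(** A linear relation between [x], [y], [1], [x * y] is a polynomial of degree at most 1 in [X],
    below the degree [q] of the curve, so it is trivial. *)
Lemma linear_fun_neq0 a : a != 0 -> linear_fun a != 0.
Proof.
apply: contraNneq => e; pose G : {poly {poly k}} :=
  ((a 0 i0)%:P + a 0 i3 *: 'X)%:P * 'X + (a 0 i1 *: 'X + (a 0 i2)%:P)%:P.
have eG : eval2 iota G x y = 0.
  rewrite -e /linear_fun sum_ord4 /segre /=.
  rewrite eval2D eval2M eval2X !eval2C !rmorphD /= !map_polyZ map_polyX !map_polyC /= !(hornerD, hornerZ, hornerC, hornerX).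
  by ring.
have sG : (size G <= 2)%N.
  apply/leq_sizeP => -[|[|i]] // _; rewrite coefD coefMX !coefC //=.
  by rewrite addr0.
have G0 : G = 0.
  apply: (ff_size (cd_ff cd) (curve_gt1 c (ltnW (cd_q cd)) (cd_s1 cd) (cd_s2 cd)) eG).
  apply: leq_ltn_trans sG _; rewrite curve_polyE size_bicurve ?(cd_s1 cd) //.
  - by have := cd_q cd; lia.
  - by have := cd_q cd; lia.
  - by rewrite -size_poly_gt0 (cd_s2 cd).
have h i j : G`_i`_j = 0 by rewrite G0 !coef0.
apply/eqP/rowP => l; rewrite mxE; elim/ord4P: l.
- by have := h 1%N 0%N; rewrite !coefE /= ?(mulr1, mulr0, addr0, add0r).
- by have := h 0%N 1%N; rewrite !coefE /= ?(mulr1, mulr0, addr0, add0r).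
- by have := h 0%N 0%N; rewrite !coefE /= ?(mulr1, mulr0, addr0, add0r).
- by have := h 1%N 1%N; rewrite !coefE /= ?(mulr1, mulr0, addr0, add0r).
Qed.

Lemma linear_ratio a P j : u P j != 0 ->
  has_value P (linear_fun a / f j) ((\sum_i a 0 i * u P i) / u P j).
Proof.
move=> uj; rewrite /linear_fun !mulr_suml; apply: has_value_sum => i _.
rewrite -!mulrA; apply: has_valueM; first exact: has_value_iota.
exact: ratio.
Qed.

Lemma ord_coord P i j : u P i != 0 -> u P j != 0 -> P (f i) = P (f j).
Proof.
move=> ui uj; have [_] := has_value_neq0 (ratio i uj) (mulf_neq0 ui (invr_neq0 uj)).
by rewrite ordpM ?invr_eq0 // ordpV => /eqP; rewrite subr_eq0 => /eqP.
Qed.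

Definition chart_index P : 'I_4 := xget ord0 [set j | u P j != 0].

Lemma chart_indexP P : u P (chart_index P) != 0.
Proof.
by rewrite /chart_index; case: xgetP => // H; have [j /H] := hcoord_neq0 (phi P).
Qed.

(** The sum of the poles of [x] and [y]: the index picks [1], [y] or [x] up to a function of order 0
    at [P]. *)
Definition pole_divisor P : int := - P (f (chart_index P)).

(** A local equation [g] has the same values as [linear_fun a / f j] on a cofinite set, so it equals
    this function. *)
Lemma hyperplane_pullbackP a (D : place iota -> int) : a != 0 ->
  hyperplane_pullback phi a D <-> forall P, D P = P (linear_fun a) + pole_divisor P.
Proof.
move=> /linear_fun_neq0 a0; split=> [h P|h P].
  have [j [U [g [oU UP g0 -> hg]]]] := h P.
  have -> : g = linear_fun a / f j.
    apply: (@eq_of_cofinite _ _ _ _ _ _ _ _ _ cd U g (linear_fun a / f j)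
       (fun Q => (\sum_i a 0 i * u Q i) / u Q j)).
    - by case: oU => // e; move: UP; rewrite e.
    - by move=> Q /hg[].
    - by move=> Q /hg[uj _]; apply: linear_ratio.
  rewrite ordpM ?invr_eq0 // ordpV /pole_divisor.
  by rewrite (ord_coord (chart_indexP P) (hg _ UP).1).
exists (chart_index P), (phi @^-1` [set L : Proj k 3 | hcoord L (chart_index P) != 0]).
exists (linear_fun a / f (chart_index P)); split.
- have X1 : ('X_(chart_index P) : {mpoly k[4]}) \is 1.-homog by rewrite dhomogX /= mdeg1.
  have [oU _] := phi_mor (proj_open_neq0 X1).
  move: oU; congr place_open; apply/seteqP; split=> Q /=; by rewrite mevalXU.
- exact: chart_indexP.
- by rewrite mulf_neq0 ?invr_eq0.
- by rewrite h ordpM ?invr_eq0 // ordpV.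
- by move=> Q uQ; split=> //; apply: linear_ratio.
Qed.

Lemma linear_systemP (D : place iota -> int) : linear_system phi D <->
  exists2 a, a != 0 & forall P, D P = P (linear_fun a) + pole_divisor P.
Proof.
by split=> -[a a0 /(hyperplane_pullbackP _ a0) h]; exists a.
Qed.

Lemma pole_bounded_of_divisor (g : K) : g != 0 ->
  (forall P, 0 <= P g + pole_divisor P) -> pole_bounded iota x y g.
Proof.
move=> g0 h.
have main P j (w : 'rV[k]_4) : (exists s, forall i, w 0 i = s * u P i) ->
    w 0 j = 1 -> ordge P (P (f j)) g.
  move=> [s es] w1.
  have uj : u P j != 0.
    by apply/negP => /eqP u0; move: w1; rewrite es u0 mulr0 => /eqP; rewrite eq_sym oner_eq0.
  right; have := h P; rewrite /pole_divisor (ord_coord (chart_indexP P) uj).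
  by rewrite subr_ge0.
split=> [P a b ha hb|P a ha hb|P b hb ha].
- have := main P i2 _ (coord_affine cd phi_mor phi_ext ha hb).
  by rewrite mxE /segre /= ordp1; apply.
- have := main P i1 _ (coord_infY cd phi_mor phi_ext ha hb).
  by rewrite mxE /segre /= (inf_uniformizer cd ha hb); apply.
- have := main P i0 _ (coord_infX cd phi_mor phi_ext hb ha).
  by rewrite mxE /segre /= (inf_uniformizer cd' hb ha); apply.
Qed.

Lemma complete_phi : complete_linear_system phi.
Proof.
(* The plane [X_2 = 0], whose [linear_fun] is the constant 1, so that [D0] is the pole divisor. *)
pose e2 : 'rV[k]_4 := row4 0 0 1 0.
have e20 : e2 != 0.
  by apply/eqP => /rowP/(_ i2); rewrite !mxE /= => /eqP; rewrite oner_eq0.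
pose D0 P := P (linear_fun e2) + pole_divisor P.
exists D0; first by apply/linear_systemP; exists e2.
apply/seteqP; split=> D.
  move=> /linear_systemP[a a0 hD]; have l0 := linear_fun_neq0 a0.
  have hD' P : D P = P (linear_fun a / f (chart_index P)).
    by rewrite hD ordpM ?invr_eq0 // ordpV.
  split.
  (* The function defining [D] near [P] varies with [P], but only among the four
     [linear_fun a / f j]. *)
  - apply: (@sub_finite_set _ _ (\bigcup_(j in [set: 'I_4])
      [set P : place iota | P (linear_fun a / f j) != 0])).
      by move=> P /= DP; exists (chart_index P) => //=; rewrite -hD'.
    apply: bigcup_finite => [|j _]; first exact: finite_finset.
    by apply: (finite_support cd); rewrite mulf_neq0 ?invr_eq0.
  - move=> P; rewrite hD'.
    apply: ordge_neq0; first by rewrite mulf_neq0 ?invr_eq0.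
    exact: has_value_ordge (linear_ratio a (chart_indexP P)).
  - exists (linear_fun a / linear_fun e2); first by rewrite mulf_neq0 ?invr_eq0 ?linear_fun_neq0.
    move=> P; rewrite hD /D0 ordpM ?invr_eq0 ?linear_fun_neq0 // ordpV opprD addrACA subrr addr0 //.
move=> [_ eD [g g0 eg]].
have [l0 hl] : linear_fun e2 != 0 /\ True by rewrite linear_fun_neq0.
have gl0 : g * linear_fun e2 != 0 by rewrite mulf_neq0.
have hg P : D P = P (g * linear_fun e2) + pole_divisor P.
  rewrite ordpM // -addrA -/(D0 P) -eg subrK //.
(* Effectivity of [D] bounds the poles of [g * linear_fun e2]; its coefficients in the span are
   those of the required plane. *)
have [|a ea] := pole_bounded_span cd (f := g * linear_fun e2).
  by apply: pole_bounded_of_divisor => // P; rewrite -hg.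
apply/linear_systemP; exists (\row_i a i).
  apply: contraNneq gl0 => a0; rewrite ea big1 // => i _.
  by move/rowP/(_ i): a0; rewrite !mxE => ->; rewrite rmorph0 mul0r.
move=> P; rewrite hg ea; congr (P _ + _).
by apply: eq_bigr => i _; rewrite mxE.
Qed.

End LinearSystem.

(** * Additive polynomials and the conclusion *)

Lemma size_additive_poly (k : fieldType) p e (alpha : 'I_e.+1 -> k) :
  (1 < p)%N -> alpha ord_max != 0 -> size (additive_poly p alpha) = (p ^ e).+1.
Proof.
move=> p1 a0; rewrite /additive_poly big_ord_recr /= addrC size_polyDl size_scale ?size_polyXn //.
apply: leq_ltn_trans (size_sum _ _ _) _; rewrite ltnS; apply/bigmax_leqP => i _.
by rewrite (leq_trans (size_scale_leq _ _)) // size_polyXn ltn_exp2l.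
Qed.

(** In characteristic [p] the exponents [p ^ j] with [j > 0] are zero, so only the linear term
    contributes. *)
Lemma deriv_additive_poly (k : fieldType) p e (alpha : 'I_e.+1 -> k) :
  p \in [pchar k] -> (additive_poly p alpha)^`() = (alpha ord0)%:P.
Proof.
move=> pk; rewrite /additive_poly raddf_sum /= big_ord_recl /= big1.
  by rewrite addr0 expn0 derivZ derivXn mulr1n expr0 alg_polyC.
by move=> i _; rewrite derivZ derivXn expnS mulrnA -[_ *+ p]mulr_natr -polyC_natr (pcharf0 pk)
  mulr0 mul0rn scaler0.
Qed.

Theorem lemma3 (k : closedFieldType) (p e : nat) (c : k)
    (alpha1 alpha2 : 'I_e.+1 -> k)
    (K : fieldType) (iota : {rmorphism k -> K}) (x y : K)
    (phi : smooth_model iota -> Proj k 3) :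
  p \in [pchar k] ->
  (1 <= e)%N ->
  (2 < p ^ e)%N ->
  c != 0 ->
  alpha1 ord_max * alpha1 ord0 != 0 ->
  alpha2 ord_max * alpha2 ord0 != 0 ->
  is_function_field iota x y
    (curve_poly (additive_poly p alpha1) (additive_poly p alpha2) c) ->
  morphism phi ->
  extends_rational_map (fun i : 'I_4 => [:: x; y; 1; x * y]`_i) phi ->
  embedding phi /\ complete_linear_system phi.

Proof.
move=> pk _ q2 c0; rewrite !mulf_eq0 !negb_or => /andP[a1 b1] /andP[a2 b2] ff phi_mor phi_ext.
have p1 : (1 < p)%N := prime_gt1 (pcharf_prime pk).
have cd : curve_data iota x y (additive_poly p alpha1) (additive_poly p alpha2) c (p ^ e).
  split=> //.
  - exact: ltnW.
  - exact: size_additive_poly.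
  - exact: size_additive_poly.
  - by exists (alpha1 ord0); rewrite ?deriv_additive_poly.
  - by exists (alpha2 ord0); rewrite ?deriv_additive_poly.
by split; [apply: (embedding_phi cd)|apply: (complete_phi cd)].
Qed.
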